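(* For every fixed real $\eta>0$ there is a constant $c=c(\eta)$ such that for every integer $n\ge c$ we have $R(C_n^{2,c},C_n^{2,c})\le (1+\eta)\frac{7n}{3}$.
   Context: $C_n$ is the cycle on $n$ vertices. A short diagonal of a cycle is a pair of vertices at distance $2$ on the cycle. $C_n^{2,c}$ denotes an ''almost'' square of the cycle $C_n$: any graph consisting of a cycle of length $n$ together with all but at most $c$ of its short diagonals. $R(C_n^{2,c},C_n^{2,c})$ denotes the smallest positive integer $N$ such that in every coloring of the edges of the complete graph $K_N$ with two colors, there is a color for which the graph formed by the edges of that color contains a cycle of length $n$ such that all but at most $c$ of the short diagonals of this cycle are also edges of that same color. *)

(* Defs.v *)
From mathcomp Require Import all_boot.

Set Implicit Arguments.
Unset Strict Implicit.
Unset Printing Implicit Defensive.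

(* Graph distance of i and j on the cycle 0, 1, ..., n-1, 0 (for 3 <= n). *)
Definition cycle_dist (n : nat) (i j : 'I_n) : nat :=
  minn ((i + n - j) %% n) ((j + n - i) %% n).

Definition pairs_at_dist (n d : nat) : {set {set 'I_n}} :=
  [set [set p.1; p.2] | p : 'I_n * 'I_n & cycle_dist p.1 p.2 == d].

Definition cycle_edges (n : nat) : {set {set 'I_n}} := pairs_at_dist n 1.

Definition short_diagonals (n : nat) : {set {set 'I_n}} := pairs_at_dist n 2.

(* The edges of K_N are the 2-element subsets of 'I_N; the values of col on
   other subsets are never used. *)
Definition color_class (N : nat) (col : {set 'I_N} -> bool) (b : bool) :
    {set {set 'I_N}} :=
  [set e : {set 'I_N} | (#|e| == 2) && (col e == b)].

(* f lists the vertices of the cycle in cyclic order. *)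
Definition contains_almost_square_cycle (N n c : nat)
    (E : {set {set 'I_N}}) : Prop :=
  3 <= n /\
  exists f : 'I_n -> 'I_N,
    [/\ injective f,
        forall e : {set 'I_n}, e \in cycle_edges n -> f @: e \in E
      & #|[set d in short_diagonals n | f @: d \notin E]| <= c].

Definition ramsey_property (n c N : nat) : Prop :=
  forall col : {set 'I_N} -> bool,
    exists b : bool, contains_almost_square_cycle n c (color_class col b).

(* N = R(C_n^{2,c}, C_n^{2,c}). *)
Definition is_ramsey_number (n c N : nat) : Prop :=
  [/\ 0 < N, ramsey_property n c N
    & forall M : nat, 0 < M -> ramsey_property n c M -> N <= M].

(* Main.v *)
(* Color K_N with N about (1 + eta) 7n/3. By the regularity lemma the vertices
   split into boundedly many clusters, and almost every pair of clusters is
   dense in one of the colors for all large subsets. Declaring two vertices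
   adjacent in a color when their clusters form such a pair gives a 2-colored
   graph in which few pairs are missing. For such graphs on more than 7n'
   vertices there are n' disjoint triangles of one color inside a component of
   that color:
   - if both colors are essentially connected, greedily removed monochromatic
     triangles suffice (6n' vertices would do);
   - otherwise a partition P | Q without red edges makes blue connected. If no
     n' disjoint blue triangles exist, remove a maximal blue packing. What
     remains either lies in one red component, where it contains n' red
     triangles, or consists of two red cliques in red components X1, X2. Let q_i
     be the maximum size of a blue matching in X_i and k the number of vertices
     outside X1 and X2. Blue edges of X_i extend to triangles by vertices of the
     other component, so q_1 + q_2 + k < n' and some X_i has at least
     3n' + q_i vertices. The unmatched part of X_i is a red clique, and a
     matching edge has an endpoint with at most one blue neighbor in it (no
     augmenting path), which yields (|X_i| - q_i)/3 red triangles.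
   A closed walk through the clusters which runs many times around each
   triangle of clusters, and changes triangle a bounded number of times, is then
   followed greedily by a cycle with exactly n vertices; only the short diagonals
   at the changes of triangle are lost. *)
Require Import Defs.
From mathcomp Require Import all_boot all_order all_algebra.
From mathcomp Require Import reals boolp zify ring lra.
Import Order.TTheory GRing.Theory Num.Theory.

Set Implicit Arguments.
Unset Strict Implicit.
Unset Printing Implicit Defensive.

(** * The Ramsey theorem for connected triangle packings *)

Lemma nat_last_true (P : nat -> Prop) (B : nat) :
  P 0 -> (forall k, P k -> k <= B) -> exists2 k, P k & ~ P k.+1.
Proof.
move=> P0 bndP; apply: contrapT => noLast.
have allP k : P k.
  elim: k => // k IHk; apply: contrapT => nPk; apply: noLast; by exists k.
by have := bndP _ (allP B.+1); rewrite ltnn.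
Qed.

(** * Vertex-disjoint triangles *)

Section Packings.
Variable T : finType.
Implicit Types (h : rel T) (S : {set T}) (F : seq (T * T * T)) (t : T * T * T).

Definition triangle h t := [&& h t.1.1 t.1.2, h t.1.1 t.2 & h t.1.2 t.2].
Definition corners t := [:: t.1.1; t.1.2; t.2].
Definition corners_of F := flatten [seq corners t | t <- F].
(** [uniq] on the concatenated corners makes the triangles disjoint and the three corners of each
    distinct. *)
Definition packing h S F :=
  [&& all (triangle h) F, uniq (corners_of F) & all (mem S) (corners_of F)].

Lemma size_corners_of F : size (corners_of F) = 3 * size F.
Proof. by elim: F => //= t F IH; rewrite IH mulnS. Qed.

Lemma packing_subset h S S' F : S \subset S' -> packing h S F -> packing h S' F.
Proof.
move=> sSS' /and3P[hF uF /allP inF]; rewrite /packing hF uF.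
by apply/allP => x /inF; apply: (subsetP sSS').
Qed.

Lemma packing_cat h S S1 S2 F1 F2 :
    S1 \subset S -> S2 \subset S -> [disjoint S1 & S2] ->
  packing h S1 F1 -> packing h S2 F2 -> packing h S (F1 ++ F2).
Proof.
move=> sS1 sS2 dS /and3P[h1 u1 /allP i1] /and3P[h2 u2 /allP i2].
rewrite /packing all_cat h1 h2 /corners_of map_cat flatten_cat cat_uniq u1 u2 /=.
rewrite all_cat andbT; apply/and3P; split.
- apply/hasPn => x /i2 xS2; apply/negP => /i1 xS1.
  by have /negP := disjointFr dS xS1.
- by apply/allP => x /i1; apply: (subsetP sS1).
- by apply/allP => x /i2; apply: (subsetP sS2).
Qed.

Lemma packing1 h t : irreflexive h -> triangle h t ->
  packing h [set x in corners t] [:: t].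
Proof.
move=> hirr ht; rewrite /packing /= ht /= !inE !eqxx !orbT !andbT !negb_or.
case/and3P: ht => h1 h2 h3.
have ne x y : h x y -> x != y by apply: contraTneq => ->; rewrite hirr.
by rewrite !ne.
Qed.

Lemma packing_cons h S t F : irreflexive h -> triangle h t ->
    {subset corners t <= S} -> packing h (S :\: [set x in corners t]) F ->
  packing h S (t :: F).
Proof.
move=> hirr ht tS; rewrite -cat1s; apply: packing_cat (packing1 hirr ht).
- by apply/subsetP => x; rewrite inE; apply: tS.
- exact: subsetDl.
- by rewrite -setI_eq0; apply/eqP/setP => x; rewrite !inE; case: (_ || _).
Qed.

Lemma packing_take h S F n : packing h S F -> packing h S (take n F).
Proof.
case/and3P=> h1 u1 i1; move: h1 u1 i1; rewrite /packing -{1 2 3}(cat_take_drop n F).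
rewrite /corners_of map_cat flatten_cat all_cat cat_uniq all_cat.
by case/andP=> -> _ /and3P[-> _ _] /andP[-> _].
Qed.

Lemma packing_mem h S F t : packing h S F -> t \in F ->
  triangle h t /\ {subset corners t <= S}.
Proof.
case/and3P=> /allP h1 _ /allP i1 tF; split; first exact: h1.
by move=> x xt; apply: i1; apply/flatten_mapP; exists t.
Qed.

Lemma maximal_packing h S : irreflexive h ->
  exists2 F, packing h S F &
    forall t, triangle h t -> ~ {subset corners t <= S :\: [set x in corners_of F]}.
Proof.
move=> hirr; have [k] := ubnP #|S|; elim: k S => // k IH S.
rewrite ltnS => leS.
have [[t [ht tS]]|no] := pselect (exists t, triangle h t /\ {subset corners t <= S});
    last first.
  exists [::] => // t ht tS; apply: no; exists t; split=> // x /tS.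
  by rewrite inE => /andP[].
have [|F pF mF] := IH (S :\: [set x in corners t]).
  apply: leq_trans leS; apply: proper_card; apply/properP; split.
    exact: subsetDl.
  by exists t.1.1; [apply: tS|]; rewrite !inE eqxx.
exists (t :: F); first exact: packing_cons.
move=> t' ht' t'S; apply: mF ht' _ => x /t'S.
by rewrite !inE /corners_of /= !negb_or -!andbA => /and5P[-> -> -> -> ->].
Qed.
End Packings.

(** * Greedy monochromatic triangles when few pairs are uncolored *)

Section AlmostComplete.
Variables (T : finType) (m : nat).

(** A pair may lie in both relations, as a pair of clusters may be dense in both colors. By
    irreflexivity [x] itself is among the at most [m] exceptions. *)
Definition almost_complete (r b : rel T) :=
  [/\ symmetric r, symmetric b, irreflexive r, irreflexive b &
      forall x, #|[set y | ~~ r x y && ~~ b x y]| <= m].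

Lemma almost_completeC r b : almost_complete r b -> almost_complete b r.
Proof.
case=> rs bs ri bi na; split=> // x.
by under eq_finset do rewrite andbC.
Qed.

Section Fixed.
Variables r b : rel T.
Hypothesis rb : almost_complete r b.

Let rs : symmetric r. Proof. by case: rb. Qed.
Let bs : symmetric b. Proof. by case: rb. Qed.
Let ri : irreflexive r. Proof. by case: rb. Qed.
Let bi : irreflexive b. Proof. by case: rb. Qed.
Let na x : #|[set y | ~~ r x y && ~~ b x y]| <= m. Proof. by case: rb. Qed.

Lemma common_adj (S : {set T}) x y : 2 * m < #|S| ->
  exists2 z, z \in S & (r x z || b x z) && (r y z || b y z).
Proof.
move=> lS; apply: contrapT => no.
suff : #|S| <= 2 * m by rewrite leqNgt lS.
apply: leq_trans (_ : #|[set z | ~~ r x z && ~~ b x z] :|: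
    [set z | ~~ r y z && ~~ b y z]| <= _).
  apply/subset_leq_card/subsetP => z zS; rewrite !inE -!negb_or -negb_and.
  by apply/negP => H; apply: no; exists z.
by apply: leq_trans (leq_card_setU _ _) _; rewrite mul2n -addnn leq_add ?na.
Qed.

(** Some color joins [x] to more than [2 * m] vertices of [S]. Among these are three that are
    pairwise adjacent in some color: an edge in the color of the neighborhood closes a triangle with
    [x], and otherwise the three form a triangle of the other color. *)
Lemma mono_triangle (S : {set T}) : 5 * m < #|S| ->
  exists2 t, {subset corners t <= S} & triangle r t || triangle b t.
Proof.
move=> lS.
have /card_gt0P [x xS] : 0 < #|S| by apply: leq_ltn_trans lS.
have step (h k : rel T) : symmetric h -> (forall u v, (h u v || k u v) = (r u v || b u v)) ->
   2 * m < #|[set y in S | h x y]| ->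
   exists2 t, {subset corners t <= S} & triangle h t || triangle k t.
  move=> hs hk lQ.
  have /card_gt0P [y yQ] : 0 < #|[set y in S | h x y]| by apply: leq_ltn_trans lQ.
  have [z zQ] := common_adj y y lQ; rewrite andbb => yz.
  have [w wQ] := common_adj y z lQ; case/andP=> yw zw.
  move: yQ zQ wQ; rewrite !inE => /andP[yS xy] /andP[zS xz] /andP[wS xw].
  rewrite -!hk in yz yw zw.
  have sub a c d : a \in S -> c \in S -> d \in S -> {subset corners (a, c, d) <= S}.
    by move=> ? ? ? u; rewrite !inE => /or3P[] /eqP->.
  have [yzh|nyz] := boolP (h y z).
    by exists (x, y, z); [exact: sub|rewrite /triangle /= xy xz yzh].
  have [ywh|nyw] := boolP (h y w).
    by exists (x, y, w); [exact: sub|rewrite /triangle /= xy xw ywh].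
  have [zwh|nzw] := boolP (h z w).
    by exists (x, z, w); [exact: sub|rewrite /triangle /= xz xw zwh].
  exists (y, z, w); first exact: sub.
  rewrite (negPf nyz) /= in yz; rewrite (negPf nyw) /= in yw.
  by rewrite (negPf nzw) /= in zw; rewrite /triangle /= yz yw zw orbT.
have cov : #|S| <= #|[set y in S | r x y]| + #|[set y in S | b x y]| + m.
  apply: leq_trans (_ : #|([set y in S | r x y] :|: [set y in S | b x y]) :|:
     [set y | ~~ r x y && ~~ b x y]| <= _).
    apply/subset_leq_card/subsetP => y yS; rewrite !inE yS /=.
    by case: (r x y); case: (b x y).
  apply: leq_trans (leq_card_setU _ _) _; apply: leq_add (na x).
  exact: leq_card_setU.
have [lr|lr] := ltnP (2 * m) #|[set y in S | r x y]|; first exact: step.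
have lb : 2 * m < #|[set y in S | b x y]| by lia.
have [t tS ht] := step b r bs (fun u v => orbC _ _) lb.
by exists t => //; rewrite orbC.
Qed.

Lemma mono_packings (S : {set T}) : exists Fr Fb,
  [/\ packing r S Fr, packing b S Fb & #|S| <= 3 * (size Fr + size Fb) + 5 * m].
Proof.
have [k] := ubnP #|S|; elim: k S => // k IH S; rewrite ltnS => leS.
have [lS|lS] := leqP #|S| (5 * m); first by exists [::], [::].
have [t tS ht] := mono_triangle lS.
have sub : [set x in corners t] \subset S by apply/subsetP => x; rewrite inE; apply: tS.
have tri3 : #|[set x in corners t]| <= 3.
  by rewrite cardsE; apply: leq_trans (card_size _) _.
have cS := cardsD S [set x in corners t]; rewrite (setIidPr sub) in cS.
have tne : 0 < #|[set x in corners t]|.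
  by apply/card_gt0P; exists t.1.1; rewrite !inE eqxx.
have cle := subset_leq_card sub.
have [|Fr [Fb [pr pb le]]] := IH (S :\: [set x in corners t]); first by lia.
case/orP: ht => ht.
- exists (t :: Fr), Fb; split; first exact: packing_cons.
    exact: packing_subset (subsetDl _ _) pb.
  rewrite /=; lia.
- exists Fr, (t :: Fb); split; last by rewrite /=; lia.
    exact: packing_subset (subsetDl _ _) pr.
  exact: packing_cons.
Qed.

Lemma packing_free (S : {set T}) :
  (forall t, triangle b t -> ~ {subset corners t <= S}) ->
  exists2 F, packing r S F & #|S| <= 3 * size F + 5 * m.
Proof.
move=> free; have [Fr [[|t Fb] [pr pb le]]] := mono_packings S.
  by exists Fr => //; rewrite addn0 in le.
have [tb tS] := packing_mem pb (mem_head _ _).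
by case: (free t).
Qed.

End Fixed.

(** * Unions of components *)

Section Closed.
Variables (r : rel T) (rs : symmetric r).

Definition closed_set (P : {set T}) := [forall x, forall y, r x y ==> (x \in P) ==> (y \in P)].
Definition component x := [set y | connect r x y].

Lemma closed_setP (P : {set T}) : reflect (forall x y, r x y -> (x \in P) = (y \in P)) (closed_set P).
Proof.
apply: (iffP idP) => [/forallP H x y xy|H].
  apply/idP/idP => i.
    by have /forallP/(_ y) := H x; rewrite xy i.
  by have /forallP/(_ x) := H y; rewrite rs xy i.
by apply/forallP => x; apply/forallP => y; apply/implyP => /H ->; apply/implyP.
Qed.

Lemma closed_component x : closed_set (component x).
Proof.
apply/closed_setP => y z yz; rewrite !inE.
by apply: same_connect_r; [apply: sym_connect_sym|apply: connect1].
Qed.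

Lemma closed_sub_component (P : {set T}) x : closed_set P -> x \in P -> component x \subset P.
Proof.
move=> /closed_setP cP xP; apply/subsetP => y; rewrite inE => /connectP[p].
elim: p x xP => [|z p IH] x xP /=; first by move=> _ ->.
by case/andP=> xz; apply: IH; rewrite -(cP _ _ xz).
Qed.

(** Take a union of components [P] that meets [U] in more than [2 * m] vertices, but in as few as
    possible. If neither [P] nor the component of a vertex of [U :&: P] does what is claimed, that
    component can be removed from [P], against minimality. *)
Lemma closed_or_component (U : {set T}) : 6 * m < #|U| ->
  (exists P, [/\ closed_set P, 2 * m < #|U :&: P| & 2 * m < #|U :\: P|]) \/
  (exists x, #|U| <= #|U :&: component x| + 2 * m).
Proof.
move=> lU; pose Q P := closed_set P && (2 * m < #|U :&: P|).
have QT : Q setT.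
  apply/andP; split; first by apply/closed_setP => x y; rewrite !inE.
  by rewrite setIT; lia.
case: (arg_minnP (fun P : {set T} => #|U :&: P|) QT) => P /andP[cP lP] minP.
have splitU A : #|U| = #|U :&: A| + #|U :\: A| by rewrite cardsID.
have [lt|le] := ltnP (2 * m) #|U :\: P|; first by left; exists P.
have UP := splitU P.
have /card_gt0P [x] : 0 < #|U :&: P| by lia.
rewrite inE => /andP[xU xP].
have UC := splitU (component x).
have [lt1|le1] := leqP #|U :\: component x| (2 * m).
  by right; exists x; lia.
have [lt2|le2] := ltnP (2 * m) #|U :&: component x|.
  by left; exists (component x); split=> //; exact: closed_component.
have sub := closed_sub_component cP xP.
have xC : x \in component x by rewrite inE connect0.
have cPC : closed_set (P :\: component x).
  apply/closed_setP => y z yz; rewrite !inE.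
  move/closed_setP: cP => cP; rewrite (cP _ _ yz).
  by have /closed_setP/(_ _ _ yz) := closed_component x; rewrite !inE => ->.
have eqC : U :&: (P :\: component x) = (U :&: P) :\: (U :&: component x).
  by apply/setP => y; rewrite !inE; case: (y \in U); rewrite /= ?andbF.
have cardC : #|U :&: P| = #|U :&: component x| + #|U :&: (P :\: component x)|.
  have subU : U :&: component x \subset U :&: P by apply: setIS.
  by rewrite eqC cardsD (setIidPr subU) subnKC // subset_leq_card.
(* Of the more than [6 * m] vertices of [U], at most [2 * m] lie outside [P] and at most [2 * m] in
   the component, so more than [2 * m] are left. *)
have /minP : Q (P :\: component x) by rewrite /Q cPC /=; lia.
have : 0 < #|U :&: component x| by apply/card_gt0P; exists x; rewrite inE xU.
lia.
Qed.
End Closed.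
End AlmostComplete.

(** * Maximum matchings *)

Section Matchings.
Variables (T : finType) (b : rel T).
Hypothesis bs : symmetric b.
Hypothesis bi : irreflexive b.
Implicit Types (S : {set T}) (M : seq (T * T)).

Definition ends (p : T * T) := [:: p.1; p.2].
Definition ends_of M := flatten [seq ends p | p <- M].
Definition matching S M :=
  [&& all (fun p => b p.1 p.2) M, uniq (ends_of M) & all (mem S) (ends_of M)].

Lemma size_ends_of M : size (ends_of M) = 2 * size M.
Proof. by elim: M => //= t M IH; rewrite IH mulnS. Qed.

Lemma matching_card S M : matching S M ->
  #|S| = #|S :\: [set x in ends_of M]| + 2 * size M.
Proof.
case/and3P=> _ u /allP i.
have sub : [set x in ends_of M] \subset S by apply/subsetP => x; rewrite inE; apply: i.
by rewrite -(cardsID [set x in ends_of M] S) (setIidPr sub) cardsE (card_uniqP u) size_ends_of addnC.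
Qed.

Lemma perm_ends_of M M' : perm_eq M M' -> perm_eq (ends_of M) (ends_of M').
Proof. by move=> pM; apply/perm_flatten/perm_map. Qed.

Lemma matching_perm S M M' : perm_eq M M' -> matching S M = matching S M'.
Proof.
move=> pM; have pE := perm_ends_of pM; rewrite /matching.
by rewrite (perm_all _ pM) (perm_uniq pE) (perm_all _ pE).
Qed.

Lemma matching_take S M n : matching S M -> matching S (take n M).
Proof.
case/and3P=> h1 u1 i1; move: h1 u1 i1; rewrite /matching -{1 2 3}(cat_take_drop n M).
rewrite /ends_of map_cat flatten_cat all_cat cat_uniq all_cat.
by case/andP=> -> _ /and3P[-> _ _] /andP[-> _].
Qed.

(** Maximality is stated against matchings with exactly one more edge, which is what an augmentation
    produces. *)
Lemma maximum_matching S : exists2 M, matching S M &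
  forall M', matching S M' -> size M' <> (size M).+1.
Proof.
have [||k [M [mM <-]] no] :=
  @nat_last_true (fun k => exists M, matching S M /\ size M = k) #|S|.
- by exists [::].
- by move=> k [M [/matching_card-> <-]]; lia.
by exists M => // M' mM' sM'; apply: no; exists M'.
Qed.

Section Maximum.
Variables (S : {set T}) (M : seq (T * T)).
Hypothesis mM : matching S M.
Hypothesis maxM : forall M', matching S M' -> size M' <> (size M).+1.
Let D := S :\: [set x in ends_of M].

Lemma unmatched_free x y : x \in D -> y \in D -> ~~ b x y.
Proof.
rewrite !inE => /andP[xM xS] /andP[yM yS]; apply/negP => xy.
apply: (maxM (M' := (x, y) :: M)) => //.
case/and3P: mM => h u i; rewrite /matching /= h u i xS yS xy !inE !negb_or xM yM.
by rewrite !andbT; apply: contraTneq xy => ->; rewrite bi.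
Qed.

Definition few_nbrs c := forall d d', d \in D -> d' \in D -> b c d -> b c d' -> d = d'.

(* Otherwise the matching edge starts an augmenting path of length 3. *)
Lemma matched_few_nbrs p : p \in M -> exists2 c, c \in ends p & few_nbrs c.
Proof.
move=> pM; apply: contrapT => no.
have two c : c \in ends p -> forall e, exists d, [/\ d \in D, b c d & d != e].
  move=> cp e; apply: contrapT => nod; apply: no; exists c => // d d' dD d'D cd cd'.
  have [de|ne] := eqVneq d e; last by case: nod; exists d.
  have [d'e|ne] := eqVneq d' e; last by case: nod; exists d'.
  by rewrite de d'e.
have [d1 [d1D b1 _]] := two p.1 (mem_head _ _) p.1.
have [|d2 [d2D b2 d21]] := two p.2 _ d1; first by rewrite !inE eqxx orbT.
have pm := perm_to_rem pM.
apply: (maxM (M' := (d1, p.1) :: (p.2, d2) :: rem p M)); last first.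
  by rewrite /= size_rem //; case: (M) pM.
move: mM (d1D) (d2D); rewrite (matching_perm S pm) /matching !inE.
rewrite !(perm_mem (perm_ends_of pm)) /= !inE !negb_or /=.
case/and3P=> /andP[_ ->] /and3P[/andP[p12 ->] -> ->] /and3P[p1S p2S ->].
case/andP=> /and3P[d1p1 d1p2 ->] d1S /andP[/and3P[d2p1 d2p2 ->] d2S].
rewrite bs b1 b2 d1S d2S p1S p2S (eq_sym d1 d2) d21 d1p1 d1p2 p12.
by rewrite (eq_sym p.1 d2) (eq_sym p.2 d2) d2p1 d2p2.
Qed.

Lemma matched_few_nbrs_seq : exists cs : seq T,
  [/\ size cs = size M, uniq cs, {subset cs <= ends_of M} &
      forall c, c \in cs -> few_nbrs c].
Proof.
have : forall p, p \in M -> exists2 c, c \in ends p & few_nbrs c.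
  exact: matched_few_nbrs.
case/and3P: mM => _ + _; elim: M => [|p M' IH]; first by exists [::].
rewrite -[ends_of (p :: M')]/(ends p ++ ends_of M') cat_uniq => /and3P[_ dis u] ex.
have [cs [sz ucs sub few]] := IH u (fun q qM => ex q (mem_behead (s := p :: M') qM)).
have [c cp fc] := ex p (mem_head _ _).
exists (c :: cs); rewrite /= sz ucs andbT; split=> //.
- apply/negP => /sub cM; move/hasPn: dis => /(_ c cM) /=.
  by move: cp; rewrite /ends => ->.
- move=> x; rewrite inE => /orP[/eqP->|/sub xM].
    by rewrite -[_ \in _]/(c \in ends p ++ ends_of M') mem_cat cp.
  by rewrite -[_ \in _]/(x \in ends p ++ ends_of M') mem_cat xM orbT.
- by move=> x; rewrite inE => /orP[/eqP->|/few].
Qed.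

End Maximum.
End Matchings.

(** * Disjoint triangles built from matchings *)

Section Assembly.
Variables (T : finType) (m : nat) (r b : rel T).
Hypothesis rb : almost_complete m r b.

Let bi : irreflexive b. Proof. by case: rb. Qed.
Let ri : irreflexive r. Proof. by case: rb. Qed.
Let rs : symmetric r. Proof. by case: rb. Qed.

Lemma assemble_edges M (Z : {set T}) :
    all (fun p => b p.1 p.2) M -> uniq (ends_of M) ->
    (forall x z, x \in ends_of M -> z \in Z -> (x != z) && ~~ r x z) ->
    size M + 2 * m <= #|Z| ->
  exists F (Z' : {set T}), [/\ size F = size M, Z' \subset Z, #|Z'| + size M = #|Z| &
    packing b ([set x in ends_of M] :|: (Z :\: Z')) F].
Proof.
elim: M Z => [|p M IH] Z; first by exists [::], Z; rewrite addn0 subxx.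
rewrite -[ends_of (p :: M)]/(ends p ++ ends_of M) /= => /andP[bp bM].
rewrite andbA => /andP[/andP[p1 p2] uM] dis lZ.
have pe : (p.1 \in ends p) && (p.2 \in ends p) by rewrite !inE !eqxx orbT.
have [|z zZ] := common_adj rb p.1 p.2 (S := Z); first by lia.
have /andP[nz1 /negPf->] := dis p.1 z (mem_head _ _) zZ.
have /andP[nz2 /negPf->] : (p.2 != z) && ~~ r p.2 z.
  by apply: dis zZ; rewrite !inE eqxx orbT.
rewrite /= => /andP[b1 b2].
have cZ : #|Z| = #|Z :\ z|.+1 by rewrite (cardsD1 z) zZ.
have [||F [Z' [sF sZ' cZ' pF]]] := IH (Z :\ z) bM uM.
- move=> x y xM; rewrite inE => /andP[_ yZ]; apply: dis yZ.
  by rewrite !inE xM !orbT.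
- by clear -lZ cZ; move: lZ => /=; lia.
exists ((p.1, p.2, z) :: F), Z'; split=> //=; first by rewrite sF.
- exact: subset_trans sZ' (subsetDl _ _).
- by rewrite addnS cZ' cZ.
apply: packing_cons => //; first by rewrite /triangle /= bp b1 b2.
  have nzZ' : z \notin Z' by apply/negP => /(subsetP sZ'); rewrite !inE eqxx.
  by move=> x; rewrite !inE => /or3P[] /eqP->; rewrite ?eqxx ?orbT ?zZ ?nzZ' ?orbT.
apply: packing_subset pF; apply/subsetP => x; rewrite !inE /= !negb_or.
case/orP=> [xM|/and3P[xZ' xz xZ]]; last first.
  have /andP[n1 _] := dis p.1 x (mem_head _ _) xZ.
  have /andP[n2 _] : (p.2 != x) && ~~ r p.2 x.
    by apply: dis xZ; rewrite !inE eqxx orbT.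
  by rewrite !(eq_sym x) n1 n2 (eq_sym z) xz xZ xZ' !orbT.
have /andP[xz _] : (x != z) && ~~ r x z by apply: dis zZ; rewrite !inE xM !orbT.
rewrite xz xM !orbT !andbT; apply/andP; split.
  by apply: contraNneq p1 => <-; rewrite inE xM orbT.
by apply: contraNneq p2 => <-.
Qed.

Lemma assemble_singles (ks : seq T) (Z1 Z2 : {set T}) :
    uniq ks ->
    (forall x z, x \in ks -> z \in Z1 :|: Z2 -> (x != z) && ~~ r x z) ->
    (forall x z, x \in Z1 -> z \in Z2 -> (x != z) && ~~ r x z) ->
    size ks + 2 * m <= #|Z1| -> size ks + 2 * m <= #|Z2| ->
  exists2 F, size F = size ks & packing b ([set x in ks] :|: (Z1 :|: Z2)) F.
Proof.
elim: ks Z1 Z2 => [|k ks IH] Z1 Z2; first by exists [::].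
move=> /= /andP[kks uks] disk dis12 l1 l2.
have [|z1 z1Z] := common_adj rb k k (S := Z1); first by lia.
rewrite andbb; have /andP[kz1 /negPf-> /=] : (k != z1) && ~~ r k z1.
  by apply: disk; rewrite inE ?eqxx ?z1Z.
move=> bkz1.
have [|z2 z2Z] := common_adj rb k z1 (S := Z2); first by lia.
have /andP[kz2 /negPf-> /=] : (k != z2) && ~~ r k z2.
  by apply: disk; rewrite inE ?eqxx ?z2Z ?orbT.
have /andP[z12 /negPf-> /=] := dis12 _ _ z1Z z2Z.
case/andP=> bkz2 bz12.
have c1 : #|Z1| = #|Z1 :\ z1|.+1 by rewrite (cardsD1 z1) z1Z.
have c2 : #|Z2| = #|Z2 :\ z2|.+1 by rewrite (cardsD1 z2) z2Z.
have [||||F sF pF] := IH (Z1 :\ z1) (Z2 :\ z2) uks.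
- move=> x z xk; rewrite !inE => zZ; apply: disk; first by rewrite inE xk orbT.
  by rewrite inE; case/orP: zZ => /andP[_ ->]; rewrite ?orbT.
- by move=> x z; rewrite !inE => /andP[_ xZ] /andP[_ zZ]; apply: dis12.
- by move: l1; rewrite c1 /= addSn ltnS.
- by move: l2; rewrite c2 /= addSn ltnS.
exists ((k, z1, z2) :: F); first by rewrite /= sF.
apply: packing_cons => //; first by rewrite /triangle /= bkz1 bkz2 bz12.
  by move=> x; rewrite !inE => /or3P[] /eqP->; rewrite ?eqxx ?z1Z ?z2Z ?orbT.
apply: packing_subset pF; apply/subsetP => x; rewrite !inE /= !negb_or.
have kZ z : z \in Z1 :|: Z2 -> z != k.
  by move=> zZ; rewrite eq_sym; case/andP: (disk k z (mem_head _ _) zZ).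
case/or3P=> [xk|/andP[xz xZ]|/andP[xz xZ]].
- have ne z : z \in Z1 :|: Z2 -> x != z.
    by move=> zZ; case/andP: (disk x z (mem_behead (s := k :: ks) xk) zZ).
  rewrite xk (ne z1) ?(ne z2) ?inE ?z1Z ?z2Z ?orbT //= !andbT.
  by apply: contraNneq kks => <-.
- rewrite xz xZ kZ ?inE ?xZ //= !orbT andbT.
  by case/andP: (dis12 _ _ xZ z2Z).
- rewrite xz xZ kZ ?inE ?xZ ?orbT //= !andbT eq_sym.
  by case/andP: (dis12 _ _ z1Z xZ).
Qed.

(** Edges of [M1] are completed by unmatched vertices of [X2], edges of [M2] by those of [X1], and
    each vertex of [ks] takes one remaining vertex on either side. The size hypotheses count the
    vertices used; [2 * m] more keep the greedy choice possible. *)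
Lemma assemble_blue (X1 X2 : {set T}) M1 M2 (ks : seq T) :
    matching b X1 M1 -> matching b X2 M2 -> uniq ks ->
    (forall x z, x \in X1 -> z \in X2 -> (x != z) && ~~ r x z) ->
    (forall x z, x \in ks -> z \in X1 :|: X2 -> (x != z) && ~~ r x z) ->
    2 * size M1 + size M2 + size ks + 2 * m <= #|X1| ->
    2 * size M2 + size M1 + size ks + 2 * m <= #|X2| ->
  exists2 F, size F = size M1 + size M2 + size ks & packing b setT F.
Proof.
move=> mM1 mM2 uk dis disk l1 l2.
have c1 := matching_card mM1; have c2 := matching_card mM2.
case/and3P: (mM1) => b1 u1 /allP i1; case/and3P: (mM2) => b2 u2 /allP i2.
have [||F1 [Z2 [s1 sub2 cZ2 p1]]] := assemble_edges (Z := X2 :\: [set x in ends_of M2]) b1 u1.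
- move=> x z /i1 xX; rewrite !inE => /andP[_]; exact: dis.
- by clear -c1 c2 l1 l2; lia.
have [||F2 [Z1 [s2 sub1 cZ1 p2]]] := assemble_edges (Z := X1 :\: [set x in ends_of M1]) b2 u2.
- move=> x z /i2 xX; rewrite !inE => /andP[_] /dis/(_ xX).
  by rewrite rs eq_sym.
- by clear -c1 c2 l1 l2; lia.
have subX1 : Z1 \subset X1 by apply: subset_trans sub1 (subsetDl _ _).
have subX2 : Z2 \subset X2 by apply: subset_trans sub2 (subsetDl _ _).
have [||||F3 s3 p3] := assemble_singles (Z1 := Z1) (Z2 := Z2) uk.
- move=> x z xk zZ; apply: disk => //; move: zZ; rewrite !inE.
  by case/orP=> [/(subsetP subX1)->|/(subsetP subX2)->]; rewrite ?orbT.
- by move=> x z /(subsetP subX1) xX /(subsetP subX2); apply: dis.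
- by clear -c1 c2 l1 l2 cZ1 cZ2; lia.
- by clear -c1 c2 l1 l2 cZ1 cZ2; lia.
exists (F1 ++ F2 ++ F3); first by rewrite !size_cat s1 s2 s3 addnA.
(* With the memberships of a vertex collected, the disjointness claims below become propositional
   and are settled by cases. *)
have facts x : [&& (x \in ends_of M1) ==> (x \in X1), (x \in ends_of M2) ==> (x \in X2),
    (x \in Z1) ==> (x \notin ends_of M1) && (x \in X1),
    (x \in Z2) ==> (x \notin ends_of M2) && (x \in X2),
    ~~ ((x \in X1) && (x \in X2)), ~~ ((x \in ks) && (x \in X1)) &
    ~~ ((x \in ks) && (x \in X2))].
  apply/and5P; split; [apply/implyP|apply/implyP|apply/implyP|apply/implyP|].
  - exact: i1.
  - exact: i2.
  - by move/(subsetP sub1); rewrite !inE.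
  - by move/(subsetP sub2); rewrite !inE.
  have kX : x \in X1 :|: X2 -> x \notin ks.
    by move=> xX; apply/negP => xk; have := disk _ _ xk xX; rewrite eqxx.
  apply/and3P; split; apply/negP => /andP[h1 h2].
  - by have := dis _ _ h1 h2; rewrite eqxx.
  - by move: h1; apply/negP; apply: kX; rewrite inE h2.
  - by move: h1; apply/negP; apply: kX; rewrite inE h2 orbT.
have disj (A B : {set T}) : (forall x, ~~ ((x \in A) && (x \in B))) -> [disjoint A & B].
  by move=> AB; apply/pred0P => x; apply/negbTE/AB.
have p23 : packing b (([set x in ends_of M2] :|: (X1 :\: [set x in ends_of M1] :\: Z1)) :|:
    ([set x in ks] :|: (Z1 :|: Z2))) (F2 ++ F3).
  apply: packing_cat (subsetUl _ _) (subsetUr _ _) _ p2 p3; apply: disj => x.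
  move: (facts x); rewrite !inE; case: (x \in ends_of M2); case: (x \in ends_of M1);
  case: (x \in X1); case: (x \in X2); case: (x \in Z1); case: (x \in Z2);
  by case: (x \in ks).
apply: packing_cat (subsetT _) (subsetT _) _ p1 p23; apply: disj => x.
move: (facts x); rewrite !inE; case: (x \in ends_of M1); case: (x \in ends_of M2);
  case: (x \in X1); case: (x \in X2); case: (x \in Z1); case: (x \in Z2);
  by case: (x \in ks).
Qed.

(** Having at most one blue neighbor in [D], each [c] forms a red triangle with two vertices of [D].
    Once [cs] is used up, the rest of [D] is packed greedily. The term [2 * size cs] pays for the
    vertices of [D] spent on [cs]. *)
Lemma red_from_matching (cs : seq T) (D : {set T}) :
    (forall x y, x \in D -> y \in D -> ~~ b x y) ->
    uniq cs -> (forall c, c \in cs -> c \notin D) ->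
    (forall c, c \in cs -> forall d d', d \in D -> d' \in D -> b c d -> b c d' -> d = d') ->
    2 * size cs + 2 * m + 2 <= #|D| ->
  exists2 F, packing r (D :|: [set x in cs]) F & #|D| + size cs <= 3 * size F + 5 * m.
Proof.
elim: cs D => [|c cs IH] D free.
  move=> _ _ _ _; have [|F pF le] := packing_free rb (S := D).
    move=> t /and3P[h _ _] tD; have h2 : t.1.2 \in D by apply: tD; rewrite !inE eqxx orbT.
    by have := free _ _ (tD _ (mem_head _ _)) h2; rewrite h.
  by exists F; rewrite ?addn0 //; apply: packing_subset pF; apply: subsetUl.
move=> /= /andP[ccs ucs] disj few lD.
have na x : #|[set y | ~~ r x y && ~~ b x y]| <= m by case: rb.
pose B := [set d in D | b c d].
have cB : #|B| <= 1.
  have [->|[d dB]] := set_0Vmem B; first by rewrite cards0.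
  rewrite (@eq_card1 _ d) // => e; apply/idP/eqP => [eB|->] //.
  move: dB eB; rewrite !inE => /andP[dD cd] /andP[eD ce].
  by apply: (few c) => //; rewrite mem_head.
(* [A], the nonneighbors of [c] and its one blue neighbor cover at most [m + m + 1] vertices of
   [D]. *)
have pick (A : {set T}) : #|A| <= m -> exists2 d, d \in D & (d \notin A) && r c d.
  move=> cA; apply: contrapT => no.
  suff : #|D| <= m + m + 1 by clear -lD; move: lD => /=; lia.
  apply: leq_trans (_ : #|(A :|: [set y | ~~ r c y && ~~ b c y]) :|: B| <= _); last first.
    apply: leq_trans (leq_card_setU _ _) (leq_add _ cB).
    exact: leq_trans (leq_card_setU _ _) (leq_add cA (na c)).
  apply/subset_leq_card/subsetP => d dD; rewrite !inE dD.
  case dA: (d \in A) => //=; case cd: (r c d) => /=; last by case: (b c d).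
  by case: no; exists d => //; rewrite dA.
have [|d dD /andP[_ cd]] := pick set0; first by rewrite cards0.
have [|d' d'D /andP[dd' cd']] := pick [set y | ~~ r d y && ~~ b d y]; first exact: na.
have rdd' : r d d'.
  by move: dd'; rewrite inE negb_and !negbK; case/orP=> // /(negP (free _ _ dD d'D)).
have ned : d' != d by apply: contraTneq rdd' => ->; rewrite ri.
have cdn : c \notin D by apply: disj; rewrite mem_head.
have cD : #|D| = #|D :\ d :\ d'|.+2.
  by rewrite (cardsD1 d) dD (cardsD1 d') !inE ned d'D.
have [|||||F pF le] := IH (D :\ d :\ d').
- by move=> x y; rewrite !inE => /and3P[_ _ xD] /and3P[_ _ yD]; apply: free.
- by [].
- by move=> x xc; rewrite !inE !negb_and (disj x) ?orbT // inE xc orbT.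
- move=> x xc e e'; rewrite !inE => /and3P[_ _ eD] /and3P[_ _ e'D].
  by apply: few => //; rewrite inE xc orbT.
- by clear -lD cD; move: lD => /=; lia.
exists ((c, d, d') :: F); last by clear -le cD; rewrite cD /= mulnS; lia.
apply: packing_cons => //; first by rewrite /triangle /= cd cd' rdd'.
  by move=> x; rewrite !inE => /or3P[] /eqP->; rewrite ?eqxx ?dD ?d'D ?orbT.
apply: packing_subset pF; apply/subsetP => x; rewrite !inE /= !negb_or.
case/orP=> [/and3P[xd' xd xD]|xc].
  by rewrite xd xd' xD !andbT /=; apply: contraNneq cdn => <-.
have xD := disj x (mem_behead (s := c :: cs) xc).
rewrite xc !orbT andbT; apply/and3P; split.
- by apply: contraNneq ccs => <-.
- by apply: contraNneq xD => ->.
- by apply: contraNneq xD => ->.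
Qed.

End Assembly.

(** * Triangles inside one component *)

Section ConnectedPacking.
Variables (T : finType) (m n : nat).

Definition connected_packing (h : rel T) :=
  exists F, [/\ packing h setT F, size F = n &
                {in corners_of F &, forall x y, connect h x y}].

Lemma connected_packing_sub (h : rel T) S F : packing h S F -> n <= size F ->
  {in S &, forall x y, connect h x y} -> connected_packing h.
Proof.
move=> pF ln cS; exists (take n F); split.
- by apply: packing_take; apply: packing_subset pF; apply: subsetT.
- by rewrite size_takel.
have /and3P[_ _ /allP sub] := packing_take n pF.
by move=> x y /sub xS /sub yS; apply: cS.
Qed.

Lemma closedC (r : rel T) (P : {set T}) : symmetric r -> closed_set r P -> closed_set r (~: P).
Proof.
move=> rs /(closed_setP rs) cP; apply/(closed_setP rs) => x y /cP.
by rewrite !inE => ->.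
Qed.

Section Colours.
Variables r b : rel T.
Hypothesis rb : almost_complete m r b.

Let rs : symmetric r. Proof. by case: rb. Qed.
Let bs : symmetric b. Proof. by case: rb. Qed.
Let bi : irreflexive b. Proof. by case: rb. Qed.

Lemma component_connect x : {in component r x &, forall y z, connect r y z}.
Proof.
move=> y z; rewrite !inE => xy xz.
by apply: connect_trans xz; rewrite sym_connect_sym.
Qed.

(** The ends of a blue edge inside [U :&: P] would have a common neighbor in [U] outside [P]; no red
    edge leaves [P], so this would be a blue triangle in [U]. *)
Lemma split_free (P U : {set T}) : closed_set r P ->
    (forall t, triangle b t -> ~ {subset corners t <= U}) ->
    2 * m < #|U :\: P| ->
  {in U :&: P &, forall x y, ~~ b x y}.
Proof.
move=> /(closed_setP rs) cP free lU x y; rewrite !inE => /andP[xU xP] /andP[yU yP].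
apply/negP => xy; have [z] := common_adj rb x y lU.
rewrite !inE => /andP[zP zU]; have nr u : u \in P -> r u z = false.
  by move=> uP; apply/negP => /cP; rewrite uP (negPf zP).
rewrite !nr //= => /andP[xz yz]; apply: (free (x, y, z)).
  by rewrite /triangle /= xy xz yz.
by move=> u; rewrite !inE => /or3P[] /eqP->.
Qed.

Lemma free_connect (V : {set T}) : {in V &, forall x y, ~~ b x y} -> 2 * m < #|V| ->
  {in V &, forall x y, connect r x y}.
Proof.
move=> free lV x y xV yV; have [z zV] := common_adj rb x y lV.
rewrite (negPf (free _ _ xV zV)) (negPf (free _ _ yV zV)) !orbF => /andP[xz yz].
by apply: connect_trans (connect1 xz) _; rewrite rs in yz; apply: connect1.
Qed.

(** The unmatched vertices and one endpoint with few blue neighbors from every matching edge make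
    [#|X| - size M] vertices. Packing them in red leaves at most [5 * m] of them uncovered. *)
Lemma red_large (X : {set T}) M : matching b X M ->
    (forall M', matching b X M' -> size M' <> (size M).+1) ->
    {in X &, forall x y, connect r x y} ->
    size M < n -> 3 * n + 5 * m + size M <= #|X| ->
  connected_packing r.
Proof.
move=> mM maxM cX ln lX.
have cD := matching_card mM.
have [cs [scs ucs sub few]] := matched_few_nbrs_seq bs mM maxM.
have [|||||F pF le] := red_from_matching rb (cs := cs) (D := X :\: [set x in ends_of M]).
- exact: (unmatched_free bi mM maxM).
- by [].
- by move=> c /sub; rewrite !inE => ->.
- by move=> c /few.
- by rewrite scs; clear -ln lX cD; lia.
have /and3P[_ _ /allP subM] := mM.
apply: (connected_packing_sub pF); first by rewrite scs in le; clear -ln lX cD le; lia.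
move=> x y; rewrite !inE => xX yX; apply: cX.
  by case/orP: xX => [/andP[_ ->]|/sub/subM].
by case/orP: yX => [/andP[_ ->]|/sub/subM].
Qed.

(** A set without blue edges contains at most one end of each matching edge. *)
Lemma clique_matching (X U : {set T}) M : matching b X M -> U \subset X ->
  {in U &, forall x y, ~~ b x y} -> #|U| + size M <= #|X|.
Proof.
case/and3P=> + + /allP; elim: M X U => [|p M IH] X U.
  by move=> _ _ _ /subset_leq_card; rewrite addn0.
rewrite -[ends_of (p :: M)]/(ends p ++ ends_of M) /= => /andP[bp bM] /and3P[n1 n2 uM] iX sUX free.
have p1X : p.1 \in X by apply: iX; rewrite inE eqxx.
have p2X : p.2 \in X by apply: iX; rewrite !inE eqxx orbT.
have ne : p.2 != p.1 by apply: contraTneq bp => ->; rewrite bi.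
have cX : #|X| = #|X :\ p.1 :\ p.2|.+2.
  by rewrite (cardsD1 p.1) p1X (cardsD1 p.2 (X :\ p.1)) !inE ne p2X.
pose V := U :\ p.1 :\ p.2.
have cU : #|U| <= #|V|.+1.
  have [p1U|p1U] := boolP (p.1 \in U).
    have p2U : p.2 \notin U by apply: contraL bp => p2U; apply: free.
    by rewrite (cardsD1 p.1) p1U (cardsD1 p.2 (U :\ p.1)) !inE (negPf p2U) andbF.
  rewrite (cardsD1 p.1) (negPf p1U) (cardsD1 p.2 (U :\ p.1)) add0n.
  by rewrite -addn1 addnC leq_add2l; case: (_ \in _).
have : #|V| + size M <= #|X :\ p.1 :\ p.2|.
  apply: IH => //.
  - move=> x xM; rewrite !inE iX ?inE ?xM ?orbT // !andbT.
    by apply/andP; split; [apply: contraNneq n2 => <-|apply: contraNneq n1 => <-; rewrite inE xM orbT].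
  - by rewrite /V !setSD.
  - by move=> x y; rewrite !inE => /and3P[_ _ xU] /and3P[_ _ yU]; apply: free.
by clear -cU cX; rewrite cX; lia.
Qed.

Lemma split_case (P : {set T}) : closed_set r P -> 2 * m < #|P| -> 2 * m < #|~: P| ->
  7 * n + 40 * m <= #|T| -> connected_packing r \/ connected_packing b.
Proof.
move=> cP lP lP' lT.
have cross x y : x \in P -> y \notin P -> r x y = false.
  by move=> xP yP; apply/negP => /(closed_setP rs _ cP); rewrite xP (negPf yP).
(* Two vertices on the same side have a common neighbor on the other side, necessarily in blue; for
   different sides one more blue edge is needed. *)
have bconn x y : connect b x y.
  have side (u : T) (Q : {set T}) : 2 * m < #|Q| -> (forall v w, v \in Q -> w \notin Q -> r w v = false) ->
     u \notin Q -> forall v, v \notin Q -> connect b u v.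
    move=> lQ crQ uQ v vQ; have [z zQ] := common_adj rb u v lQ.
    rewrite !crQ //= => /andP[uz vz]; rewrite bs in vz.
    exact: connect_trans (connect1 uz) (connect1 vz).
  have sP := side _ P lP; have sP' := side _ (~: P) lP'.
  have crP v w : v \in P -> w \notin P -> r w v = false by move=> vP wP; rewrite rs cross.
  have crP' v w : v \in ~: P -> w \notin ~: P -> r w v = false.
    by rewrite !inE negbK => vP wP; rewrite cross.
  have mixed u v : u \in P -> v \notin P -> connect b u v.
    move=> uP vP; have [z zP'] := common_adj rb u u lP'; rewrite andbb.
    rewrite inE in zP'; rewrite cross //= => uz.
    apply: connect_trans (connect1 uz) _; exact: sP.
  have [xP|xP] := boolP (x \in P); have [yP|yP] := boolP (y \in P).
  - by apply: sP' => //; rewrite inE negbK.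
  - exact: mixed.
  - by rewrite sym_connect_sym //; apply: mixed.
  - exact: sP.
have bdone F : packing b setT F -> n <= size F -> connected_packing b.
  by move=> pF nF; apply: (connected_packing_sub pF nF) => x y _ _; apply: bconn.
have [F pF free] := maximal_packing setT bi.
have [nF|nF] := leqP n (size F); first by right; apply: bdone nF.
set U := setT :\: [set x in corners_of F] in free.
have cU : #|T| = #|U| + 3 * size F.
  have /and3P[_ u _] := pF.
  have := cardsC [set x in corners_of F]; rewrite cardsE (card_uniqP u) size_corners_of.
  by rewrite -setTD -/U => <-; rewrite addnC.
have redpack (S : {set T}) : S \subset U -> 3 * n + 5 * m <= #|S| ->
    {in S &, forall x y, connect r x y} -> connected_packing r.
  move=> sSU lS cS; have [|F' pF' le] := packing_free rb (S := S).
    by move=> t tt tS; apply: free tt _ => x /tS; apply: (subsetP sSU).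
  by apply: (connected_packing_sub pF') cS; clear -lS le; lia.
have lU : 6 * m < #|U| by clear -lT cU nF; lia.
(* From here on [P] cuts the remainder [U] instead of the whole vertex set. A red component holding
   almost all of [U] already has room for [n] red triangles. *)
clear lP lP' cross; have [[{}P [{}cP lP1 lP2]]|[x lx]] := closed_or_component rs lU; last first.
  left; apply: (redpack (U :&: component r x)); first exact: subsetIl.
    by clear -lx lT cU nF; lia.
  by move=> y z; rewrite !(inE, in_setI) => /andP[_ yx] /andP[_ zx]; apply: (@component_connect x); rewrite inE.
have cross x y : x \in P -> y \notin P -> r x y = false.
  by move=> xP yP; apply/negP => /(closed_setP rs _ cP); rewrite xP (negPf yP).
have lP1' : 2 * m < #|U :\: ~: P| by rewrite setDE setCK.
have lP2' : 2 * m < #|U :&: ~: P| by rewrite -setDE.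
have f1 := split_free cP free lP2.
have f2 := split_free (closedC rs cP) free lP1'.
have c1 := free_connect f1 lP1; have c2 := free_connect f2 lP2'.
have U12 : #|U| = #|U :&: P| + #|U :&: ~: P| by rewrite -setDE cardsID.
have [l1|l1] := leqP (3 * n + 5 * m) #|U :&: P|.
  by left; apply: redpack l1 c1; apply: subsetIl.
have [l2|l2] := leqP (3 * n + 5 * m) #|U :&: ~: P|.
  by left; apply: redpack l2 c2; apply: subsetIl.
have /card_gt0P [x1 x1U] : 0 < #|U :&: P| by clear -lP1; lia.
have /card_gt0P [x2 x2U] : 0 < #|U :&: ~: P| by clear -lP2'; lia.
pose X1 := component r x1; pose X2 := component r x2.
have sX1 : X1 \subset P.
  by apply: closed_sub_component => //; move: x1U; rewrite inE => /andP[].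
have sX2 : X2 \subset ~: P.
  by apply: closed_sub_component => //; [apply: closedC|move: x2U; rewrite inE => /andP[]].
have sU1 : U :&: P \subset X1 by apply/subsetP => y yU; rewrite inE; apply: c1.
have sU2 : U :&: ~: P \subset X2 by apply/subsetP => y yU; rewrite inE; apply: c2.
have [M1 mM1 max1] := maximum_matching b X1.
have [M2 mM2 max2] := maximum_matching b X2.
have x1q := clique_matching mM1 sU1 f1.
have x2q := clique_matching mM2 sU2 f2.
pose K := ~: (X1 :|: X2).
have disj12 x : x \in X1 -> x \in X2 -> False.
  by move=> /(subsetP sX1) xP /(subsetP sX2); rewrite inE xP.
have cT : #|T| = #|X1| + #|X2| + #|K|.
  rewrite -(cardsC (X1 :|: X2)) cardsU (_ : X1 :&: X2 = set0) ?cards0 ?subn0 //.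
  apply/setP => x; rewrite in_setI in_set0; apply/negbTE/negP => /andP[].
  exact: disj12.
have [small|large] := ltnP (size M1 + size M2 + #|K|) n; last first.
  (* The three kinds of blue triangles are truncated to [n] in all. There is room: [U] has at least
     [4 * n + 40 * m] vertices and each part fewer than [3 * n + 5 * m], so each part has more than
     [n + 2 * m]. *)
  right; pose q1 := minn (size M1) n; pose q2 := minn (size M2) (n - q1).
  pose k := n - q1 - q2.
  have lk : k <= size (enum K) by rewrite -cardE; clear -large; rewrite /k /q1 /q2; lia.
  have clX x y z : r y z -> (y \in component r x) = (z \in component r x).
    by move/(closed_setP rs _ (closed_component rs x)).
  have [||||F' sF' pF'] := assemble_blue rb (matching_take q1 mM1) (matching_take q2 mM2)
    (take_uniq k (enum_uniq K)).
  - move=> x z xX zX; apply/andP; split.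
      by apply/negP => /eqP xz; apply: (disj12 x) => //; rewrite xz.
    by rewrite cross //; [apply: (subsetP sX1)|have := subsetP sX2 _ zX; rewrite inE].
  - move=> x z /mem_take; rewrite mem_enum => xK zX; apply/andP; split.
      by apply: contraTneq xK => ->; rewrite in_setC zX.
    apply: contraL xK => xz; rewrite in_setC negbK in_setU.
    by rewrite !(clX _ _ _ xz) -in_setU.
  - rewrite !size_take_min; clear -x1q U12 l2 cU nF lT lk; rewrite /k /q1 /q2 in lk *; lia.
  - rewrite !size_take_min; clear -x2q U12 l1 cU nF lT lk; rewrite /k /q1 /q2 in lk *; lia.
  apply: bdone pF' _; rewrite sF' !size_take_min.
  clear -large lk; rewrite /k /q1 /q2 in lk *; lia.
have cX1 : {in X1 &, forall x y, connect r x y} := @component_connect x1.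
have cX2 : {in X2 &, forall x y, connect r x y} := @component_connect x2.
(* If [X1] is too small, then [#|X2| = #|T| - #|X1| - #|K|] exceeds
   [4 * n + 35 * m - size M1 - #|K|], which exceeds [3 * n + 35 * m + size M2]. This is where
   [7 * n] enters. *)
left; have [h1|h1] := leqP (3 * n + 5 * m + size M1) #|X1|.
  by apply: (red_large mM1 max1 cX1) => //; clear -small; lia.
apply: (red_large mM2 max2 cX2); first by clear -small; lia.
clear -h1 small cT lT; lia.
Qed.

End Colours.

Lemma almost_connected (r b : rel T) : almost_complete m r b -> 
  6 * m < #|T| -> (exists P, [/\ closed_set r P, 2 * m < #|P| & 2 * m < #|~: P|]) \/
  exists x, #|~: component r x| <= 2 * m.
Proof.
case=> rs _ _ _ _; rewrite -cardsT => lT.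
have [[P [cP]]|[x]] := closed_or_component rs lT.
  by rewrite setTI setTD => l1 l2; left; exists P.
by rewrite setTI cardsT -(cardsC (component r x)) leq_add2l; right; exists x.
Qed.

(** If neither color has a cut, each has a component missing at most [2 * m] vertices. Greedy
    triangles inside the intersection suffice, since fewer than [n] of each color cannot exhaust
    it. *)
Theorem ramsey_connected_packing (r b : rel T) : almost_complete m r b ->
  7 * n + 40 * m <= #|T| -> connected_packing r \/ connected_packing b.
Proof.
move=> rb lT; have br := almost_completeC rb.
have [n0|n_gt0] := posnP n; first by left; exists [::].
have lT6 : 6 * m < #|T| by clear -n_gt0 lT; lia.
have [[P [cP l1 l2]]|[x cx]] := almost_connected rb lT6; first exact: (split_case rb cP).
have [[P [cP l1 l2]]|[y cy]] := almost_connected br lT6.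
  by apply/or_comm; apply: (split_case br cP).
pose S := component r x :&: component b y.
have lS : #|T| <= #|S| + 4 * m.
  have := cardsC S; rewrite setCI.
  have := (leq_card_setU (~: component r x) (~: component b y)).1.
  by clear -cx cy; lia.
have [Fr [Fb [pr pb le]]] := mono_packings rb S.
have rs : symmetric r by case: rb.
have bs : symmetric b by case: rb.
have [ln|ln] := leqP n (size Fr).
  left; apply: (connected_packing_sub pr ln) => u v /setIP[ux _] /setIP[vx _].
  exact: (component_connect rb ux).
right; apply: (connected_packing_sub pb); first by clear -ln lS le lT; lia.
move=> u v /setIP[_ ux] /setIP[_ vx]; exact: (component_connect br ux).
Qed.

End ConnectedPacking.

(** * A regularity lemma *)

Section Averages.
Variables (T : finType).
Local Open Scope ring_scope.

Section Average.
Variables (S : eqType) (g : T -> S).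

(** The conditional expectation of [h] on the partition into classes of equal [g]. *)
Definition average (h : T -> rat) (x : T) : rat :=
  (\sum_(u | g u == g x) h u) / #|[set u | g u == g x]|%:R.

Lemma class_gt0 x : (0 < #|[set u | g u == g x]|)%N.
Proof. by apply/card_gt0P; exists x; rewrite inE. Qed.

Lemma class_neq0 x : #|[set u | g u == g x]|%:R != 0 :> rat.
Proof. by rewrite pnatr_eq0 -lt0n class_gt0. Qed.

Lemma sum_average (p h : T -> rat) :
    (forall x y, g x = g y -> p x = p y) ->
  \sum_x p x * average h x = \sum_x p x * h x.
Proof.
move=> pg; rewrite /average.
under eq_bigr => x _ do rewrite mulrA mulr_sumr mulr_suml big_mkcond /=.
rewrite exchange_big /=; apply: eq_bigr => u _.
rewrite -big_mkcond /=.
rewrite (eq_bigr (fun=> p u * h u / #|[set v | g v == g u]|%:R)); last first.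
  by move=> x /eqP gux; rewrite (pg x u) // -gux.
rewrite sumr_const -[LHS]mulr_natr -[RHS](divfK (class_neq0 u)); congr (_ * _%:R).
by apply: eq_card => x; rewrite !inE eq_sym.
Qed.

Lemma average_range (h : T -> rat) x :
  (forall u, 0 <= h u <= 1) -> 0 <= average h x <= 1.
Proof.
move=> h01; apply/andP; split.
  by rewrite divr_ge0 ?ler0n // sumr_ge0 // => u _; case/andP: (h01 u).
rewrite ler_pdivrMr ?ltr0n ?class_gt0 // mul1r.
apply: le_trans (ler_sum _ (_ : forall u, g u == g x -> h u <= 1)) _.
  by move=> u _; case/andP: (h01 u).
by rewrite sumr_const ler_nat; apply: eq_leq; apply: eq_card => u; rewrite inE.
Qed.

Lemma average_const (h : T -> rat) x y : g x = g y -> average h x = average h y.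
Proof. by rewrite /average => ->. Qed.

Lemma eq_average (h h' : T -> rat) x : h =1 h' -> average h x = average h' x.
Proof. by move=> hh; rewrite /average; under eq_bigr do rewrite hh. Qed.
End Average.

Variable e : rel T.

(** The edge density between the classes of [x] and [y], as a function of two vertices so that sums
    weight the blocks by their sizes. *)
Definition block_density (S : eqType) (g : T -> S) (x y : T) : rat :=
  average g (fun u => average g (fun v => (e u v)%:R) y) x.

Definition energy (S : eqType) (g : T -> S) : rat :=
  \sum_x \sum_y block_density g x y ^+ 2.

Lemma block_density_const (S : eqType) (g : T -> S) x x' y y' :
  g x = g x' -> g y = g y' -> block_density g x y = block_density g x' y'.
Proof.
move=> gx gy; rewrite /block_density (average_const _ gx).
by apply: eq_average => u; apply: average_const.
Qed.

Lemma block_density_range (S : eqType) (g : T -> S) x y : 0 <= block_density g x y <= 1.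
Proof.
apply: average_range => u; apply: average_range => v.
by rewrite ler0n lern1 leq_b1.
Qed.

Lemma sum_block_density (S : eqType) (g : T -> S) (p : T -> T -> rat) :
    (forall x x' y y', g x = g x' -> g y = g y' -> p x y = p x' y') ->
  \sum_x \sum_y p x y * block_density g x y = \sum_x \sum_y p x y * (e x y)%:R.
Proof.
move=> pg; rewrite exchange_big /=.
under eq_bigr => y _.
  rewrite (sum_average (g := g) (p := fun x => p x y)); last by move=> x x' gx; apply: pg.
  over.
rewrite exchange_big /=; apply: eq_bigr => x _.
by apply: sum_average => y y' gy; apply: pg.
Qed.

Lemma energy_le (S : eqType) (g : T -> S) : energy g <= #|T|%:R ^+ 2.
Proof.
apply: (@le_trans _ _ (\sum_(x : T) \sum_(y : T) 1)).
  apply: ler_sum => x _; apply: ler_sum => y _.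
  by have /andP[d0 d1] := block_density_range g x y; rewrite expr_le1.
by rewrite !sumr_const expr2 mulr_natr.
Qed.

(** Pythagoras: the coarse density is constant on the blocks of both partitions, so both densities
    have the same sum against it, and it is orthogonal to their difference. *)
Lemma energy_refine (S S' : eqType) (f : T -> S) (g : T -> S') :
    (forall x y, g x = g y -> f x = f y) ->
  energy g = energy f +
    \sum_x \sum_y (block_density g x y - block_density f x y) ^+ 2.
Proof.
move=> fg.
have dfg x x' y y' : g x = g x' -> g y = g y' -> block_density f x y = block_density f x' y'.
  by move=> /fg fx /fg fy; apply: block_density_const.
have E1 := sum_block_density dfg.
have E2 := sum_block_density (@block_density_const _ f).
have E3 : \sum_x \sum_y block_density f x y * (block_density g x y - block_density f x y) = 0.
  under eq_bigr => x _ do (under eq_bigr => y _ do rewrite mulrBr; rewrite sumrB).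
  by rewrite sumrB E1 E2 subrr.
set gain := (X in _ = _ + X); rewrite -[gain]addr0.
have -> : 0 = 2 * 0 :> rat by rewrite mulr0.
rewrite -[in 2 * _]E3 /energy /gain mulr_sumr -!big_split /=; apply: eq_bigr => x _.
rewrite mulr_sumr -!big_split /=; apply: eq_bigr => y _.
by ring.
Qed.

End Averages.

Definition edges (T : finType) (e : rel T) (X Y : {set T}) : nat :=
  \sum_(x in X) \sum_(y in Y) e x y.

Definition fiber (T : finType) (I : eqType) (f : T -> I) (i : I) : {set T} := [set x | f x == i].

(** * Energy increment from irregular pairs *)

Section Irregular.
Variables (T : finType) (e : rel T) (K E : nat) (f : T -> 'I_K).
Hypothesis E_gt0 : (0 < E)%N.
Local Open Scope ring_scope.
Local Notation fib := (fiber f).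

Lemma sum_edges (X Y : {set T}) :
  (edges e X Y)%:R = \sum_(x in X) \sum_(y in Y) (e x y)%:R :> rat.
Proof. by rewrite natr_sum; apply: eq_bigr => x _; rewrite natr_sum. Qed.

Definition pair_density (i j : 'I_K) : rat :=
  (edges e (fib i) (fib j))%:R / (#|fib i| * #|fib j|)%:R.

Lemma block_pair_density x y : block_density e f x y = pair_density (f x) (f y).
Proof.
rewrite /block_density /average /pair_density sum_edges natrM invfM -mulr_suml.
rewrite -mulrA [_^-1 * _^-1]mulrC; congr (_ * _).
apply: eq_big => [u|u _]; first by rewrite inE.
by apply: eq_bigl => v; rewrite inE.
Qed.

(** Irregularity with [1 / E] both as relative size of the subsets and as deviation of the density,
    multiplied out. *)
Definition deviates i j (p : {set T} * {set T}) :=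
  [&& p.1 \subset fib i, p.2 \subset fib j, (#|fib i| <= E * #|p.1|)%N,
      (#|fib j| <= E * #|p.2|)%N &
      #|p.1|%:R * #|p.2|%:R <
        E%:R * `|(edges e p.1 p.2)%:R - pair_density i j * (#|p.1|%:R * #|p.2|%:R)|].

Definition irregular i j := [exists p, deviates i j p].

(** The default is met only at regular pairs, where it cuts nothing off. *)
Definition witness i j := odflt (set0, set0) [pick p | deviates i j p].

Lemma witnessP i j : irregular i j -> deviates i j (witness i j).
Proof.
case/existsP=> p dp; rewrite /witness; case: pickP => [//|/(_ p)].
by rewrite dp.
Qed.

(** Each class is cut by its witness sets as first and as second member of every pair, into at most
    [4 ^ K] pieces. *)
Definition refinement x : 'I_K * {ffun 'I_K -> bool * bool} :=
  (f x, [ffun j => (x \in (witness (f x) j).1, x \in (witness j (f x)).2)]).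

Local Notation gain x y := ((block_density e refinement x y - block_density e f x y) ^+ 2).

Lemma sum_rect (X Y : {set T}) (F : T -> T -> rat) :
  \sum_(x in X) \sum_(y in Y) F x y =
  \sum_x \sum_y ((x \in X)%:R * (y \in Y)%:R) * F x y.
Proof.
rewrite big_mkcond /=; apply: eq_bigr => x _; case: (x \in X); last first.
  by rewrite big1 // => y _; rewrite !mul0r.
rewrite big_mkcond /=; apply: eq_bigr => y _.
by case: (y \in Y); rewrite !mul1r ?mul0r.
Qed.

(** The witness sets are unions of classes of the refinement. *)
Lemma sum_witness i j : irregular i j ->
  let: (X, Y) := witness i j in
  \sum_(x in X) \sum_(y in Y) block_density e refinement x y = (edges e X Y)%:R.
Proof.
move=> /witnessP; case wE: (witness i j) => [X Y] /and5P[/= /subsetP sX /subsetP sY _ _ _].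
rewrite sum_edges !sum_rect; apply: sum_block_density => x x' y y' gx gy.
have rX u u' : refinement u = refinement u' -> u \in X -> u' \in X.
  case=> fu /ffunP/(_ j); rewrite !ffunE => -[+ _] uX.
  by have := sX _ uX; rewrite inE -fu => /eqP->; rewrite wE /= uX => <-.
have rY u u' : refinement u = refinement u' -> u \in Y -> u' \in Y.
  case=> fu /ffunP/(_ i); rewrite !ffunE => -[_ +] uX.
  by have := sY _ uX; rewrite inE -fu => /eqP->; rewrite wE /= uX => <-.
congr (_%:R * _%:R); congr nat_of_bool.
  by apply/idP/idP; [apply: rX|apply: rX].
by apply/idP/idP; [apply: rY|apply: rY].
Qed.

(** On the witness pair the mean of the change in density exceeds [1 / E] in absolute value. By
    Cauchy-Schwarz the gain is at least [#|X| * #|Y| / E ^ 2], and each witness set is at least a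
    part [1 / E] of its class. *)
Lemma irregular_gain i j : irregular i j ->
  (#|fib i| * #|fib j|)%:R <= E%:R ^+ 4 * (\sum_(x in fib i) \sum_(y in fib j) gain x y).
Proof.
move=> irr; have := sum_witness irr; have := witnessP irr.
case wE: (witness i j) => [X Y] /and5P[/= sX sY cX cY dev] sumE.
have sub : \sum_(x in X) \sum_(y in Y) gain x y <= \sum_(x in fib i) \sum_(y in fib j) gain x y.
  rewrite [leRHS](big_setID X) /= (setIidPr sX) -[leLHS]addr0; apply: lerD.
    apply: ler_sum => x _.
    rewrite [leRHS](big_setID Y) /= (setIidPr sY) -[leLHS]addr0; apply: lerD => //.
    by apply: sumr_ge0 => y _; apply: sqr_ge0.
  by apply: sumr_ge0 => x _; apply: sumr_ge0 => y _; apply: sqr_ge0.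
set D := edges e X Y in sumE dev.
set n := #|X|%:R * #|Y|%:R in dev.
set dlt := D%:R - pair_density i j * n in dev.
have sumd : \sum_(x in X) \sum_(y in Y)
    (block_density e refinement x y - block_density e f x y) = dlt.
  under eq_bigr do rewrite sumrB.
  rewrite sumrB sumE; congr (_ - _).
  rewrite (eq_bigr (fun=> \sum_(y in Y) pair_density i j)); last first.
    move=> x /(subsetP sX); rewrite inE => /eqP fx; apply: eq_bigr => y /(subsetP sY).
    by rewrite inE => /eqP fy; rewrite block_pair_density fx fy.
  by rewrite !sumr_const -mulrnA /n -natrM mulr_natr mulnC.
have [s s2 sdlt] : exists2 s : rat, s ^+ 2 = 1 & s * dlt = `|dlt|.
  have [d0|d0] := leP 0 dlt.
    by exists 1; rewrite ?expr1n // mul1r ger0_norm.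
  by exists (-1); rewrite ?sqrrN ?expr1n // mulN1r ltr0_norm.
(* Cauchy-Schwarz in the form (E a - s)^2 >= 0, summed over X * Y *)
have low : n <= E%:R ^+ 2 * \sum_(x in X) \sum_(y in Y) gain x y.
  have : 2 * E%:R * s * dlt - n <= E%:R ^+ 2 * \sum_(x in X) \sum_(y in Y) gain x y.
    have nE : n = \sum_(x in X) \sum_(y in Y) 1.
      by rewrite !sumr_const -mulrnA /n -natrM mulnC.
    rewrite -sumd nE !mulr_sumr -sumrB; apply: ler_sum => x _.
    rewrite !mulr_sumr -sumrB; apply: ler_sum => y _.
    set a := block_density _ _ _ _ - _; rewrite -subr_ge0.
    have -> : E%:R ^+ 2 * a ^+ 2 - (2 * E%:R * s * a - 1) = (E%:R * a - s) ^+ 2.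
      by rewrite [RHS]sqrrB s2; ring.
    exact: sqr_ge0.
  move=> h; apply: le_trans h.
  have -> : 2 * E%:R * s * dlt = 2 * (E%:R * `|dlt|) by rewrite -sdlt; ring.
  by move: dev; set A := _ * `|_|; lra.
apply: le_trans (_ : E%:R ^+ 2 * n <= _).
  rewrite /n -natrM -natrX -natrM ler_nat.
  by rewrite expnS expn1 mulnACA leq_mul.
apply: le_trans (ler_wpM2l _ low) _; first by rewrite exprn_ge0.
by rewrite mulrA -exprD ler_wpM2l // exprn_ge0.
Qed.

(** Pairs of vertices are counted, which weights the possibly very unequal classes by their
    sizes. *)
Definition irregular_pairs : {set T * T} := [set p | irregular (f p.1) (f p.2)].

Lemma card_irregular : #|irregular_pairs| = (\sum_i \sum_(j | irregular i j) #|fib i| * #|fib j|)%N.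
Proof.
rewrite -sum1_card (eq_bigl (fun p => true && irregular (f p.1) (f p.2))); last by move=> p; rewrite inE.
rewrite -(pair_big_dep predT (fun x y => irregular (f x) (f y)) (fun _ _ => 1%N)) /=.
rewrite (partition_big f predT) //=; apply: eq_bigr => i _.
rewrite (eq_bigr (fun=> \sum_(j | irregular i j) #|fib j|)%N); last first.
  move=> x /eqP fx; rewrite (partition_big f (irregular i)) /=; last by move=> y; rewrite fx.
  apply: eq_bigr => j ij; rewrite sum1_card; apply: eq_card => y.
  rewrite !inE [in LHS]unfold_in /=.
  by apply/andP/eqP => [[_ /eqP]|->] //; rewrite fx ij.
rewrite sum_nat_const big_distrr /=; apply: eq_bigr => j _.
by congr (_ * _)%N; apply: eq_card => x; rewrite !inE.
Qed.

Lemma energy_gain :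
  energy e f + #|irregular_pairs|%:R / E%:R ^+ 4 <= energy e refinement.
Proof.
rewrite [leRHS](energy_refine e (f := f)); last by move=> x y [].
rewrite lerD2l ler_pdivrMr ?exprn_gt0 ?ltr0n // mulrC.
rewrite [in leRHS](partition_big f predT) //= mulr_sumr card_irregular natr_sum.
apply: ler_sum => i _.
under [in leRHS]eq_bigr => x _ do rewrite (partition_big f predT) //=.
rewrite exchange_big /= mulr_sumr natr_sum big_mkcond /=.
apply: ler_sum => j _.
have -> : \sum_(x | f x == i) \sum_(y | f y == j) gain x y =
   \sum_(x in fib i) \sum_(y in fib j) gain x y.
  apply: eq_big => [x|x _]; first by rewrite inE.
  by apply: eq_bigl => y; rewrite inE.
case: ifP => [/irregular_gain//|_].
rewrite mulr_ge0 ?exprn_ge0 //.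
by apply: sumr_ge0 => x _; apply: sumr_ge0 => y _; apply: sqr_ge0.
Qed.

End Irregular.

(** * Density on all large subsets *)

Section Dense.
Variables (T : finType) (E : nat).
Implicit Types (e : rel T) (A B X Y : {set T}).

Definition dense e A B :=
  [forall X : {set T}, forall Y : {set T},
    [&& X \subset A, Y \subset B, #|A| <= E * #|X| & #|B| <= E * #|Y|] ==>
      (#|X| * #|Y| <= 3 * edges e X Y)].

Lemma denseP e A B : reflect
  (forall X Y, X \subset A -> Y \subset B -> #|A| <= E * #|X| -> #|B| <= E * #|Y| ->
     #|X| * #|Y| <= 3 * edges e X Y) (dense e A B).
Proof.
apply: (iffP forallP) => [H X Y sX sY cX cY|H X].
  by have /forallP/(_ Y) := H X; rewrite sX sY cX cY.
by apply/forallP => Y; apply/implyP => /and4P[]; apply: H.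
Qed.

Lemma edges_sym e X Y : symmetric e -> edges e X Y = edges e Y X.
Proof.
move=> es; rewrite /edges exchange_big /=; apply: eq_bigr => x _.
by apply: eq_bigr => y _; rewrite es.
Qed.

Lemma dense_sym e A B : symmetric e -> dense e A B = dense e B A.
Proof.
move=> es; apply/denseP/denseP => H X Y sX sY cX cY.
  by rewrite mulnC edges_sym //; apply: H.
by rewrite mulnC edges_sym //; apply: H.
Qed.

Lemma edges_compl e X Y : edges e X Y + edges (fun x y => ~~ e x y) X Y = #|X| * #|Y|.
Proof.
rewrite -big_split -sum_nat_const /=; apply: eq_bigr => x _.
by rewrite -big_split -sum1_card /=; apply: eq_bigr => y _; case: (e x y).
Qed.
End Dense.

(** One of the two complementary densities is at least [1 / 2]; regularity costs at most [1 / 6] and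
    leaves the [1 / 3] in [dense]. *)
Lemma regular_dense (T : finType) (e : rel T) K E (f : T -> 'I_K) i j : 6 <= E ->
  ~~ irregular e E f i j ->
  dense E e (fiber f i) (fiber f j) || dense E (fun x y => ~~ e x y) (fiber f i) (fiber f j).
Proof.
move=> E6 reg.
have dev (X Y : {set T}) : X \subset fiber f i -> Y \subset fiber f j ->
   #|fiber f i| <= E * #|X| -> #|fiber f j| <= E * #|Y| ->
   (6 * `|(edges e X Y)%:R - pair_density e f i j * (#|X|%:R * #|Y|%:R)| <=
     #|X|%:R * #|Y|%:R :> rat)%R.
  move=> sX sY cX cY; move: reg; rewrite negb_exists => /forallP/(_ (X, Y)).
  rewrite /deviates /= sX sY cX cY /= -leNgt; apply: le_trans.
  by apply: ler_wpM2r => //; rewrite (ler_nat _ 6).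
have [d2|d2] := leP (1 / 2)%R (pair_density e f i j).
  apply/orP; left; apply/denseP => X Y sX sY cX cY.
  have := dev X Y sX sY cX cY; rewrite -(ler_nat rat) !natrM.
  set n := (#|X|%:R * #|Y|%:R)%R; set D := ((edges e X Y)%:R)%R.
  have n0 : (0 <= n)%R by rewrite mulr_ge0.
  have : (1 / 2 * n <= pair_density e f i j * n)%R by rewrite ler_wpM2r.
  move: (pair_density e f i j * n)%R => p h1 h2.
  have : (p - D <= `|D - p|)%R by rewrite distrC ler_norm.
  by lra.
apply/orP; right; apply/denseP => X Y sX sY cX cY.
have := dev X Y sX sY cX cY; have /(congr1 (fun k => k%:R : rat)%R) := edges_compl e X Y.
rewrite -(ler_nat rat) !natrM natrD.
set n := (#|X|%:R * #|Y|%:R)%R; set D := ((edges e X Y)%:R)%R; set D' := (X in (_ + X)%R = _).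
have n0 : (0 <= n)%R by rewrite mulr_ge0.
have : (pair_density e f i j * n <= 1 / 2 * n)%R by rewrite ler_wpM2r // ltW.
move: (pair_density e f i j * n)%R => p h1 h2 h3.
have : (D - p <= `|D - p|)%R by rewrite ler_norm.
by lra.
Qed.

Lemma energy_inj (T : finType) (e : rel T) (S S' : eqType) (f : T -> S) (h : S -> S') :
  injective h -> energy e (h \o f) = energy e f.
Proof.
move=> hi; have av u x : average (h \o f) u x = average f u x.
  rewrite /average; congr (_ / _%:R)%R; first by apply: eq_bigl => y; rewrite /= inj_eq.
  by apply: eq_card => y; rewrite !inE /= inj_eq.
rewrite /energy; apply: eq_bigr => x _; apply: eq_bigr => y _.
by rewrite /block_density av; congr (_ ^+ 2)%R; apply: eq_average => z; rewrite av.
Qed.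

(** * Iterating the refinement *)

Section Iteration.
Variable E : nat.
Hypothesis E_gt0 : 0 < E.

(** [k] bounds the rounds left: with too many irregular pairs, a refinement gains more than
    [#|T| ^ 2 / E ^ 5] in energy, while the energy never exceeds [#|T| ^ 2]. *)
Lemma regularity_iter k K : exists Kmax, forall (T : finType) (e : rel T) (f : T -> 'I_K),
  ((#|T|%:R ^+ 2 - energy e f) * E%:R ^+ 5 <= k%:R * #|T|%:R ^+ 2 :> rat)%R ->
  exists K' (f' : T -> 'I_K'), [/\ K' <= Kmax, forall x y, f' x = f' y -> f x = f y &
     #|irregular_pairs e E f'| * E <= #|T| ^ 2].
Proof.
elim: k K => [|k IH] K.
  exists K => T e f; rewrite mul0r pmulr_lle0 ?exprn_gt0 ?ltr0n // subr_le0 => full.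
  exists K, f; split=> //.
  have := le_trans (energy_gain e f E_gt0) (energy_le e _).
  move=> /(le_trans (lerD full (lexx _))).
  rewrite gerDl pmulr_lle0 ?invr_gt0 ?exprn_gt0 ?ltr0n // lern0 => /eqP->.
  by rewrite mul0n.
have [Kmax IHK] := IH #|{: 'I_K * {ffun 'I_K -> bool * bool}}|.
exists (maxn K Kmax) => T e f defect.
have [reg|irr] := leqP (#|irregular_pairs e E f| * E) (#|T| ^ 2).
  by exists K, f; split; rewrite ?leq_maxl.
have [|K' [f' [leK ref reg]]] := IHK T e (enum_rank \o refinement e E f).
  rewrite energy_inj; last exact: enum_rank_inj.
  have gain := energy_gain e f E_gt0.
  have E5 : (0 < E%:R ^+ 5 :> rat)%R by rewrite exprn_gt0 ?ltr0n.
  have : (#|T|%:R ^+ 2 <= #|irregular_pairs e E f|%:R / E%:R ^+ 4 * E%:R ^+ 5 :> rat)%R.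
    rewrite (exprS _ 4) mulrCA divfK ?expf_neq0 ?pnatr_eq0 ?gtn_eqF //.
    by rewrite -natrX -natrM ler_nat mulnC ltnW.
  move: defect gain; set a := (_ / _)%R; set b := (#|T|%:R ^+ 2)%R.
  rewrite -(natr1 k) => h1 h2 h3.
  have : ((energy e f + a) * E%:R ^+ 5 <= energy e (refinement e E f) * E%:R ^+ 5)%R.
    by rewrite ler_wpM2r // ltW.
  move: h1 h3; rewrite !mulrBl !mulrDl mul1r; lra.
exists K', f'; split=> //; first by rewrite leq_max leK orbT.
by move=> x y /ref /= /enum_rank_inj [].
Qed.

Lemma equipartition_mod (T : finType) : exists f : T -> 'I_E,
  forall i, #|fiber f i| * E <= #|T| + E.
Proof.
exists (fun x => Ordinal (ltn_pmod (enum_rank x) E_gt0)) => i.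
set A := fiber _ i.
pose h (x : T) : 'I_(#|T| %/ E).+1 := inord (enum_rank x %/ E).
have hE x : h x = enum_rank x %/ E :> nat.
  by rewrite inordK // ltnS leq_div2r // ltnW.
have hinj : {in A &, injective h}.
  move=> x y; rewrite !inE => /eqP/(congr1 val) /= ex /eqP/(congr1 val) /= ey.
  move/(congr1 val); rewrite /= !hE => exy; apply/enum_rank_inj/val_inj => /=.
  by rewrite (divn_eq (enum_rank x) E) (divn_eq (enum_rank y) E) ex ey exy.
rewrite -(card_in_imset hinj); apply: (@leq_trans ((#|T| %/ E).+1 * E)).
  by rewrite leq_mul2r -[X in _ <= X]card_ord max_card orbT.
by rewrite mulSn addnC leq_add2r leq_trunc_div.
Qed.

(** The bound on class sizes holds for the starting partition and passes to refinements; it takes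
    the place of an equipartition. Energy starts nonnegative, whence [E ^ 5] rounds. *)
Theorem regularity : exists Kmax, forall (T : finType) (e : rel T),
  exists K (f : T -> 'I_K), [/\ K <= Kmax, forall i, #|fiber f i| * E <= #|T| + E &
     #|irregular_pairs e E f| * E <= #|T| ^ 2].
Proof.
have [Kmax HK] := regularity_iter (E ^ 5) E; exists Kmax => T e.
have [f0 small] := equipartition_mod T.
have [|K [f [leK ref reg]]] := HK T e f0.
  rewrite mulrC natrX ler_wpM2l ?exprn_ge0 // gerBl.
  by apply: sumr_ge0 => x _; apply: sumr_ge0 => y _; apply: sqr_ge0.
exists K, f; split=> // i; have [->|[x xi]] := set_0Vmem (fiber f i).
  by rewrite cards0 mul0n.
apply: leq_trans (small (f0 x)); rewrite leq_mul2r subset_leq_card ?orbT //.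
apply/subsetP => y; move: xi; rewrite !inE => /eqP fx /eqP fy.
by apply/eqP/ref; rewrite fx fy.
Qed.
End Iteration.

(** * Reduction to a coloring of the clusters *)

Lemma connect_map (T T' : finType) (e : rel T) (e' : rel T') (g : T -> T') x y :
  (forall u v, e u v -> e' (g u) (g v)) -> connect e x y -> connect e' (g x) (g y).
Proof.
move=> eg /connectP[p]; elim: p x => [|z p IH] x /=; first by move=> _ ->.
by case/andP=> /eg xz /IH zy /zy; apply: connect_trans (connect1 xz).
Qed.

Definition map_triple (T T' : Type) (g : T -> T') (t : T * T * T) := (g t.1.1, g t.1.2, g t.2).

Lemma corners_of_map (T T' : finType) (g : T -> T') F :
  corners_of (map (map_triple g) F) = map g (corners_of F).
Proof. by rewrite /corners_of map_flatten -!map_comp. Qed.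

Section Blocks.
Variables (T : finType) (h : rel T) (E D K : nat) (f : T -> 'I_K) (G : rel 'I_K).

Definition dense_blocks := [/\ symmetric G, irreflexive G & forall i j, G i j ->
  dense E h (fiber f i) (fiber f j) && (#|T| <= D * #|fiber f i|)].

(** [L] may repeat triangles: it is a packing of clusters weighted by their sizes. *)
Definition block_triangles n (L : seq ('I_K * 'I_K * 'I_K)) :=
  [/\ all (triangle G) L, size L = n,
      forall i, count_mem i (corners_of L) <= #|fiber f i| &
      {in corners_of L &, forall i j, connect G i j}].
End Blocks.

Section Reduction.
Variables (T : finType) (e : rel T) (E F K : nat) (f : T -> 'I_K).
Hypothesis es : symmetric e.
Hypothesis F_gt0 : 0 < F.
Hypothesis E6 : 6 <= E.
Hypothesis EF : F * F <= E.
Hypothesis small : forall i, #|fiber f i| * E <= #|T| + E.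
Hypothesis reg : #|irregular_pairs e E f| * E <= #|T| ^ 2.
Hypothesis TF : F <= #|T|.

Let big i := #|T| <= K * F * #|fiber f i|.
Let irr x := [set y | irregular e E f (f x) (f y)].
Let good : {set T} := [set x | big (f x) && (#|irr x| * F <= #|T|)].

Let G c i j := [&& i != j, dense E (fun x y => e x y == c) (fiber f i) (fiber f j), big i & big j].

Let small_blocks : #|[set x | ~~ big (f x)]| * F <= #|T|.
Proof.
have [->|[x0 _]] := set_0Vmem [set x | ~~ big (f x)]; first by rewrite cards0.
have K_gt0 : 0 < K by apply: leq_ltn_trans (ltn_ord (f x0)).
rewrite -(leq_pmul2l K_gt0).
rewrite -sum1_card (partition_big f predT) //= !big_distrl /= big_distrr /=.
have -> : K * #|T| = \sum_(i < K) #|T| by rewrite sum_nat_const card_ord.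
apply: leq_sum => i _.
rewrite sum1_card; have [bi|/ltnW nbi] := leqP #|T| (K * F * #|fiber f i|).
  rewrite eq_card0 ?mul0n ?muln0 // => x; rewrite !inE; apply/negP => /andP[+ /eqP fx].
  by rewrite inE fx /big bi.
apply: leq_trans nbi; rewrite -mulnA leq_mul2l [_ * F]mulnC leq_mul2l.
apply/orP; right; apply/orP; right.
by apply/subset_leq_card/subsetP => x; rewrite !inE => /andP[_].
Qed.

(** Double counting: each such vertex is in more than [#|T| / F] irregular pairs, of which there are
    at most [#|T| ^ 2 / E], and [F * F <= E]. *)
Let bad_blocks : #|[set x | ~~ (#|irr x| * F <= #|T|)]| * F <= #|T|.
Proof.
set B := [set _ | _].
have T_gt0 : 0 < #|T| by apply: leq_trans TF.
have cB : #|B| * #|T| <= #|irregular_pairs e E f| * F.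
  apply: (@leq_trans (\sum_(x in B) #|irr x| * F)).
    by rewrite -sum_nat_const; apply: leq_sum => x; rewrite inE -ltnNge => /ltnW.
  rewrite -big_distrl /= leq_mul2r; apply/orP; right.
  rewrite -[leqRHS]sum1_card (eq_bigl (fun p => true && irregular e E f (f p.1) (f p.2))); last first.
    by move=> p; rewrite inE.
  rewrite -(pair_big_dep predT (fun x y => irregular e E f (f x) (f y)) (fun _ _ => 1)) /=.
  rewrite big_mkcond /=; apply: leq_sum => x _; case: ifP => // _.
  by rewrite sum1_card; apply: eq_leq; apply: eq_card => y; rewrite !inE.
rewrite -(leq_pmul2l T_gt0) mulnA [#|T| * #|B|]mulnC.
apply: leq_trans (_ : #|irregular_pairs e E f| * E <= _); last by rewrite (leq_trans reg) // expnS expn1.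
apply: (@leq_trans (#|irregular_pairs e E f| * F * F)); first by rewrite leq_mul2r cB orbT.
by rewrite -mulnA leq_mul2l EF orbT.
Qed.

Let card_good : F * #|T| <= F * #|good| + 2 * #|T|.
Proof.
have := cardsC good.
have : #|~: good| <= #|[set x | ~~ big (f x)]| + #|[set x | ~~ (#|irr x| * F <= #|T|)]|.
  apply: leq_trans (leq_card_setU _ _); apply/subset_leq_card/subsetP => x.
  by rewrite !inE negb_and.
move: small_blocks bad_blocks.
set a := #|_|; set b := #|_|; set c := #|_|; set d := #|_|.
clear; nia.
Qed.

Let T' := {x : T | x \in good}.
(** The blow-up of [G c] to the good vertices. Packing vertices instead of clusters makes clusters
    count by their sizes. *)
Let r c : rel T' := fun x y => G c (f (val x)) (f (val y)).
Let m := (3 * #|T|) %/ F.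

Let G_sym c : symmetric (G c).
Proof.
move=> i j; rewrite /G eq_sym dense_sym; last by move=> x y; rewrite es.
by case: (_ != _); case: dense; rewrite //= andbC.
Qed.

(** A vertex can miss only its own cluster, of at most [2 * #|T| / F] vertices, and the at most
    [#|T| / F] vertices in clusters irregular to its own. *)
Let almost : almost_complete m (r true) (r false).
Proof.
have sym c : symmetric (r c) by move=> x y; apply: G_sym.
have irf c : irreflexive (r c) by move=> x; rewrite /r /G eqxx.
split=> // x; rewrite leq_divRL //.
have sub : val @: [set y | ~~ r true x y && ~~ r false x y] \subset
    fiber f (f (val x)) :|: irr (val x).
  apply/subsetP => _ /imsetP[y + ->]; rewrite !inE -negb_or; apply: contraNT.
  rewrite negb_or eq_sym => /andP[fxy /(regular_dense E6)].
  have := valP x; have := valP y; rewrite !inE => /andP[by_ _] /andP[bx _].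
  rewrite /r /G fxy bx by_ !andbT /=.
  have -> : (fun x y => e x y == true) = e by apply/funext => u; apply/funext => v; rewrite eqb_id.
  by have -> : (fun x y => e x y == false) = (fun x y => ~~ e x y)
     by apply/funext => u; apply/funext => v; rewrite eqbF_neg.
rewrite -(card_imset _ val_inj).
apply: leq_trans (leq_mul (leq_trans (subset_leq_card sub) (leq_card_setU _ _)) (leqnn F)) _.
have := valP x; rewrite inE => /andP[_ ir]; rewrite mulnDl.
have sm : #|fiber f (f (val x))| * F <= 2 * #|T|.
  have sm := small (f (val x)).
  have h : #|fiber f (f (val x))| * (F * F) <= #|T| * F + F * F.
    have [h|h] := leqP #|fiber f (f (val x))| 1.
      apply: leq_trans (leq_mul h (leqnn _)) _; rewrite mul1n; exact: leq_addl.
    have : (#|fiber f (f (val x))|.-1) * (F * F) <= #|T| * F.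
      apply: (@leq_trans (#|fiber f (f (val x))|.-1 * E)); first by rewrite leq_mul2l EF orbT.
      apply: (@leq_trans #|T|); last by rewrite leq_pmulr.
      by rewrite -(leq_add2r E) -mulSnr prednK // (leq_trans _ h).
    by rewrite -{2}(prednK (leq_trans (isT : 0 < 1) (ltnW h))) mulSnr => H; rewrite leq_add2r.
  rewrite -(leq_pmul2r F_gt0) -mulnA; apply: leq_trans h _.
  by rewrite mul2n -addnn mulnDl leq_add2l leq_mul2r TF orbT.
by move: ir sm; clear; lia.
Qed.

Lemma reduced_triangles n : 7 * n * F + 122 * #|T| <= F * #|T| ->
  exists c L, dense_blocks (fun x y => e x y == c) E (K * F) f (G c) /\
              block_triangles f (G c) n L.
Proof.
move=> nT.
(* [122 = 2 + 3 * 40]: at most [2 * #|T| / F] vertices are not good, and [40 * m] is at most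
   [120 * #|T| / F]. *)
have lT : 7 * n + 40 * m <= #|{: T'}|.
  rewrite -(leq_pmul2l F_gt0) card_sig.
  have -> : #|[pred x | x \in good]| = #|good| by apply: eq_card.
  have : m * F <= 3 * #|T| by apply: leq_trunc_div.
  by move: card_good nT; clear; lia.
have blocks c : dense_blocks (fun x y => e x y == c) E (K * F) f (G c).
  split; [exact: G_sym|by move=> i; rewrite /G eqxx|].
  by move=> i j /and4P[_ -> bi _].
have conv c : connected_packing n (r c) -> exists L, block_triangles f (G c) n L.
  case=> P [/and3P[/allP tP uP _] sP cP].
  exists (map (map_triple (f \o val)) P); split.
  - by apply/allP => _ /mapP[t /tP tt ->].
  - by rewrite size_map.
  - move=> i; rewrite corners_of_map count_map.
    rewrite -size_filter -(size_map val) -(card_uniqP _); last first.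
      by rewrite map_inj_uniq ?filter_uniq //; apply: val_inj.
    apply/subset_leq_card/subsetP => _ /mapP[y + ->]; rewrite mem_filter => /andP[fy _].
    by rewrite inE.
  - rewrite corners_of_map => _ _ /mapP[x xP ->] /mapP[y yP ->].
    exact: connect_map (cP x y xP yP).
have [/conv[L HL]|/conv[L HL]] := ramsey_connected_packing almost lT.
  by exists true, L.
by exists false, L.
Qed.
End Reduction.

(** * Embedding along closed walks of clusters *)

Section Embedding.
Variables (T : finType) (h : rel T) (E D K : nat) (f : T -> 'I_K) (G : rel 'I_K).
Hypothesis E_gt0 : 0 < E.
Hypothesis blocks : dense_blocks h E D f G.

Let Gi : irreflexive G. Proof. by case: blocks. Qed.

(** The least size above a part [1 / E] of the cluster, so that [dense] applies to subsets of this
    size. *)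
Definition threshold i := (#|fiber f i| %/ E).+1.
Definition nbrs x (Y : {set T}) := [set y in Y | h x y].

Lemma nbrs_sub x Y : nbrs x Y \subset Y.
Proof. by apply/subsetP => y; rewrite inE => /andP[]. Qed.

Lemma thresholdP i (X : {set T}) : threshold i <= #|X| -> #|fiber f i| <= E * #|X|.
Proof.
rewrite /threshold => le; apply: leq_trans (ltnW (ltn_ceil #|fiber f i| E_gt0)) _.
by rewrite mulnC leq_mul2l le orbT.
Qed.

(** Otherwise these vertices would form a large set sending too few edges to [Y]. *)
Lemma few_low i j (Y : {set T}) : G i j -> Y \subset fiber f j -> threshold j <= #|Y| ->
  #|[set x in fiber f i | 3 * #|nbrs x Y| < #|Y|]| < threshold i.
Proof.
move=> Gij sY lY; set X := [set x in _ | _]; rewrite ltnNge; apply/negP => lX.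
have [_ _ /(_ _ _ Gij)/andP[/denseP dn _]] := blocks.
have sX : X \subset fiber f i by apply/subsetP => x; rewrite inE => /andP[].
have := dn X Y sX sY (thresholdP lX) (thresholdP lY); apply/negP; rewrite -ltnNge.
rewrite /edges big_distrr /= -sum_nat_const.
have /card_gt0P[x0 x0X] : 0 < #|X| by apply: leq_trans lX.
have E1 x : x \in X -> 3 * (\sum_(y in Y) h x y) < #|Y|.
  rewrite inE => /andP[_]; rewrite /nbrs -sum1_card big_mkcond /= [in X in _ -> X]big_mkcond /=.
  congr (_ * _ < _); apply: eq_bigr => y _; rewrite inE.
  by case: (y \in Y) => //=; case: (h x y).
rewrite (bigD1 x0) //= [X in _ < X](bigD1 x0) //= -addSn; apply: leq_add; first exact: E1.
by apply: leq_sum => x /andP[xX _]; apply/ltnW/E1.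
Qed.

Implicit Types (w : seq ('I_K * {set T})) (Us : {set T}).

(* However the vertices of the earlier items are picked in their sets, the set
   of every item q keeps at least 18 * threshold q.1 unused vertices. *)
Fixpoint roomy Us w : Prop :=
  if w is q :: w' then
    18 * threshold q.1 <= #|q.2 :\: Us| /\ forall x, x \in q.2 -> roomy (x |: Us) w'
  else True.

(** An earlier item takes at most one vertex of [q.2], and only if its set meets [q.2]. *)
Lemma roomyP Us w :
  (forall w1 (q : 'I_K * {set T}) w2, w = w1 ++ q :: w2 ->
     18 * threshold q.1 + count (fun q' : 'I_K * {set T} => ~~ [disjoint q'.2 & q.2]) w1 <= #|q.2 :\: Us|) ->
  roomy Us w.
Proof.
elim: w Us => //= q w IH Us H; split.
  by have := H [::] q w erefl; rewrite addn0.
move=> x xq; apply: IH => w1 q' w2 ww.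
have := H (q :: w1) q' w2; rewrite ww => /(_ erefl) /=.
have -> : q'.2 :\: (x |: Us) = (q'.2 :\: Us) :\ x by rewrite setUC -setDDl.
rewrite (cardsD1 x (q'.2 :\: Us)).
have : (x \in q'.2 :\: Us) <= ~~ [disjoint q.2 & q'.2].
  have [dis|//] := boolP [disjoint q.2 & q'.2]; last by case: (_ \in _).
  by rewrite inE (disjointFr dis xq) andbF.
by case: (_ \in _); case: (~~ _) => //= _; clear; lia.
Qed.

(** Vertices are chosen in order; [N1] and [N2] hold the candidates for the next two, given the
    earlier choices. The vertex chosen in [N1] must see a third of [N2] and, if the diagonal is
    wanted, a third of the free part of the third set: 18 thresholds become 6 and then 2. Two
    thresholds allow the choice, as each demand rules out less than one. *)
Lemma embed w Us (N1 N2 : {set T}) (x0 : T) (q0 : 'I_K * {set T}) :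
    roomy Us w ->
    (forall j, j.+1 < size w -> G (nth q0 w j).1 (nth q0 w j.+1).1) ->
    (forall q : 'I_K * {set T}, q \in w -> q.2 \subset fiber f q.1) ->
    (0 < size w -> N1 \subset (nth q0 w 0).2 :\: Us /\ 2 * threshold (nth q0 w 0).1 <= #|N1|) ->
    (1 < size w -> N2 \subset (nth q0 w 1).2 :\: Us /\ 6 * threshold (nth q0 w 1).1 <= #|N2|) ->
  exists v, [/\ [/\ size v = size w, uniq v & {in v, forall x, x \notin Us}],
    forall j, j < size w -> nth x0 v j \in (nth q0 w j).2,
    (0 < size w -> nth x0 v 0 \in N1) /\ (1 < size w -> nth x0 v 1 \in N2),
    forall j, j.+1 < size w -> h (nth x0 v j) (nth x0 v j.+1) &
    forall j, j.+2 < size w -> G (nth q0 w j).1 (nth q0 w j.+2).1 ->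
      h (nth x0 v j) (nth x0 v j.+2)].
Proof.
elim: w Us N1 N2 => [|q1 w IH] Us N1 N2.
  by exists [::].
move=> rm Gw fw /(_ isT) [/= sN1 lN1] HN2.
have N1_gt0 : 0 < #|N1| by apply: leq_trans lN1; rewrite muln_gt0.
have inN1 x : x \in N1 -> x \in q1.2 /\ x \notin Us.
  by move=> /(subsetP sN1); rewrite inE => /andP[].
case: w IH rm Gw fw HN2 => [|q2 w] IH rm Gw fw HN2.
  have /card_gt0P[x xN1] := N1_gt0; have [xq xU] := inN1 _ xN1.
  exists [:: x]; split=> //; first by split=> // y; rewrite inE => /eqP->.
  by case.
have [/= sN2 lN2] := HN2 isT.
have G12 : G q1.1 q2.1 := Gw 0 isT.
have f1 : q1.2 \subset fiber f q1.1 by apply: fw; rewrite mem_head.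
have f2 : q2.2 \subset fiber f q2.1 by apply: fw; rewrite !inE eqxx orbT.
have sN2f : N2 \subset fiber f q2.1 by apply: subset_trans sN2 (subset_trans (subsetDl _ _) f2).
have N2_gt0 : 0 < #|N2| by apply: leq_trans lN2; rewrite muln_gt0.
have inN2 x : x \in N2 -> x \in q2.2 /\ x \notin Us.
  by move=> /(subsetP sN2); rewrite inE => /andP[].
case: rm => /= _ rm.
have apart i j x y : x \in fiber f i -> y \in fiber f j -> G i j -> x != y.
  rewrite !inE => /eqP<- /eqP<-; apply: contraTneq => ->; by rewrite Gi.
have low1 : #|[set x in fiber f q1.1 | 3 * #|nbrs x N2| < #|N2|]| < threshold q1.1.
  by apply: few_low G12 sN2f _; apply: leq_trans lN2; rewrite leq_pmull.
pose q3 := nth q0 w 0; pose B3 := q3.2 :\: Us.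
have big3 : 0 < size w -> 18 * threshold q3.1 <= #|B3|.
  move=> w0; have /card_gt0P[x /inN1[xq _]] := N1_gt0.
  have /card_gt0P[y /inN2[yq _]] := N2_gt0.
  have := (rm x xq).2 y yq; rewrite /B3 /q3; case: (w) w0 => //= q3' _ _ [+ _].
  move=> le; apply: leq_trans le _; apply/subset_leq_card/setDS.
  by rewrite setUA subsetUr.
have f3 : 0 < size w -> B3 \subset fiber f q3.1.
  move=> w0; apply: subset_trans (subsetDl _ _) (fw _ _).
  by rewrite !inE mem_nth // !orbT.
have [x xN1 /andP[dx2 dx3]] : exists2 x, x \in N1 & (#|N2| <= 3 * #|nbrs x N2|) &&
   ((0 < size w) && G q1.1 q3.1 ==> (#|B3| <= 3 * #|nbrs x B3|)).
  apply: contrapT => no.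
  pose L1 := [set x in fiber f q1.1 | 3 * #|nbrs x N2| < #|N2|].
  pose L2 := [set x in fiber f q1.1 | [&& 0 < size w, G q1.1 q3.1 & 3 * #|nbrs x B3| < #|B3|]].
  have low2 : #|L2| < threshold q1.1.
    have [/andP[w0 G13]|nG] := boolP ((0 < size w) && G q1.1 q3.1); last first.
      rewrite (_ : #|L2| = 0) //; apply: eq_card0 => x; rewrite !inE.
      by rewrite (andbA (0 < _)) (negPf nG) andbF.
    rewrite /L2 w0 G13; apply: few_low G13 (f3 w0) _.
    by apply: leq_trans (big3 w0); rewrite leq_pmull.
  have : #|N1| <= #|L1 :|: L2|.
    apply/subset_leq_card/subsetP => x xN1; have [xq _] := inN1 _ xN1.
    rewrite !inE; have := subsetP f1 _ xq; rewrite inE => -> /=.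
    rewrite ltnNge; have [d2|//] /= := boolP (#|N2| <= _).
    apply/negPn/negP => d3; apply: no; exists x => //; rewrite d2 /=.
    by apply/implyP => /andP[w0 G13]; move: d3; rewrite w0 G13 /= -leqNgt.
  have := (leq_card_setU L1 L2).1; rewrite -/L1 in low1.
  by clear -lN1 low1 low2; lia.
have [xq xU] := inN1 _ xN1; have xf := subsetP f1 _ xq.
have xN2 y : y \in N2 -> x != y by move=> /(subsetP sN2f) yf; apply: apart xf yf G12.
pose N1' := nbrs x N2.
(* Without an edge of [G] from the first to the third cluster the diagonal is given up, and every
   free vertex stays a candidate. *)
pose N2' := if G q1.1 q3.1 then nbrs x B3 else q3.2 :\: (x |: Us).
have lN1' : 2 * threshold q2.1 <= #|N1'| by clear -lN2 dx2; rewrite /N1'; lia.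
have sN1' : N1' \subset q2.2 :\: (x |: Us).
  apply/subsetP => y; rewrite !inE => /andP[yN2 _]; have [yq yU] := inN2 _ yN2.
  by rewrite yq negb_or yU eq_sym xN2.
have [|||||v [[sv uv vU] vB [v0 v1] vh vd]] := IH (x |: Us) N1' N2'.
- exact: rm.
- by move=> j lj; apply: (Gw j.+1).
- by move=> q qw; apply: fw; rewrite inE qw orbT.
- by [].
- move=> /= w0; have w0' : 0 < size w by [].
  rewrite -/q3 /N2'; case: ifP => [G13|_].
    rewrite w0' G13 /= in dx3; split; last by have := big3 w0'; clear -dx3; lia.
    apply/subsetP => y yn; have /(subsetP (nbrs_sub _ _)) yB := yn.
    have yf := subsetP (f3 w0') _ yB; move: yB; rewrite !inE => /andP[yU ->].
    by rewrite negb_or yU eq_sym (apart _ _ _ _ xf yf G13).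
  split=> //; have /card_gt0P[y /(subsetP sN1')] : 0 < #|N1'|.
    by apply: leq_trans lN1'; rewrite muln_gt0.
  rewrite inE => /andP[_ yq].
  have := (rm x xq).2 y yq; rewrite /q3; case: (w) w0' => //= q3' _ _ [+ _].
  move=> le; apply: (@leq_trans (18 * threshold q3'.1)); first by rewrite leq_mul2r orbT.
  apply: leq_trans le _; apply/subset_leq_card/setDS; exact: subsetUr.
exists (x :: v); split.
- split; rewrite /= ?sv //.
    by rewrite uv andbT; apply/negP => /vU; rewrite !inE eqxx.
  move=> y; rewrite inE => /orP[/eqP->//|/vU].
  by rewrite !inE negb_or => /andP[].
- by case=> [|j] //= lj; apply: vB.
- split=> //= _; have := v0 isT; exact: (subsetP (nbrs_sub _ _)).
- case=> [|j] lj; last by apply: vh.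
  by have := v0 isT; rewrite !inE => /andP[].
- case=> [|j] lj; last by apply: vd.
  move=> /= G13; have := v1 lj; rewrite /N2' /q3.
  by move: G13; rewrite -/q3 /= => ->; rewrite inE => /andP[].
Qed.
End Embedding.

Lemma exists_subset (T : finType) (A : {set T}) k : k <= #|A| ->
  exists2 B : {set T}, B \subset A & #|B| = k.
Proof.
move=> kA; exists [set x in take k (enum A)].
  by apply/subsetP => x; rewrite inE => /mem_take; rewrite mem_enum.
by rewrite cardsE (card_uniqP (take_uniq _ (enum_uniq _))) size_takel // -cardE.
Qed.

(** * Closing the path to a cycle *)

Section EmbeddingCycle.
Variables (T : finType) (h : rel T) (E D K : nat) (f : T -> 'I_K) (G : rel 'I_K).
Hypothesis hs : symmetric h.
Hypothesis E_gt0 : 0 < E.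
Hypothesis blocks : dense_blocks h E D f G.

Let Gs : symmetric G. Proof. by case: blocks. Qed.
Let Gi : irreflexive G. Proof. by case: blocks. Qed.
Local Notation threshold := (threshold E f).

Lemma fiber_disjoint i j x : x \in fiber f i -> x \in fiber f j -> i = j.
Proof. by rewrite !inE => /eqP<- /eqP<-. Qed.

(** The first vertex is fixed beforehand with many neighbors in the second and the last cluster;
    [embed] finds the others, the last one among these neighbors. Diagonals that contain the first
    vertex or cross the closing edge are not claimed. *)
Lemma embed_cycle s0 s1 mid sl (x0 : T) (w := s0 :: s1 :: rcons mid sl) :
    cycle G w ->
    (forall i, i \in w -> count_mem i w + 109 * threshold i <= #|fiber f i|) ->
  exists v, [/\ size v = size w, uniq v,
    forall j, j.+1 < size w -> h (nth x0 v j) (nth x0 v j.+1),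
    h (last x0 v) (nth x0 v 0) &
    forall j, 0 < j -> j.+2 < size w -> G (nth s0 w j) (nth s0 w j.+2) ->
      h (nth x0 v j) (nth x0 v j.+2)].
Proof.
move=> cw room.
have s0w : s0 \in w by rewrite mem_head.
have s1w : s1 \in w by rewrite !inE eqxx orbT.
have slw : sl \in w by rewrite !inE mem_rcons mem_head !orbT.
have [G01 Gsl0] : G s0 s1 /\ G sl s0.
  move: cw; rewrite /w /= rcons_path last_rcons.
  by case/andP=> -> /andP[_ ->].
have th i : 0 < threshold i by [].
(* S0 is reserved for the last vertex of the cycle, a neighbor of the first
   vertex v0. *)
have [|S0 sS0 cS0] := @exists_subset _ (fiber f sl) (54 * threshold sl).
  by have := room _ slw; clear; lia.
pose R1 := fiber f s1 :\: S0.
(* 54 is three times 18: a third of the set, seen by [v0], is still enough for [roomy]. *)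
have cR1 : 54 * threshold s1 <= #|R1|.
  have r1 := room _ s1w; rewrite /R1 cardsD.
  have [ne|ne] := eqVneq s1 sl.
    have := subset_leq_card (subsetIr (fiber f s1) S0); rewrite cS0 ne.
    by rewrite ne in r1; clear -r1; lia.
  rewrite (_ : _ :&: _ = set0) ?cards0; first by clear -r1; lia.
  apply/setP => x; rewrite !inE; apply/negP => /andP[/eqP x1 /(subsetP sS0)].
  by rewrite inE x1; apply/negP.
have [v0 v0f /andP[dS0 dR1]] : exists2 x, x \in fiber f s0 &
    (#|S0| <= 3 * #|nbrs h x S0|) && (#|R1| <= 3 * #|nbrs h x R1|).
  apply: contrapT => no.
  pose L1 := [set x in fiber f s0 | 3 * #|nbrs h x S0| < #|S0|].
  pose L2 := [set x in fiber f s0 | 3 * #|nbrs h x R1| < #|R1|].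
  have low1 : #|L1| < threshold s0.
    apply: few_low E_gt0 blocks _ _ _ _ sS0 _; first by rewrite Gs.
    by rewrite cS0 leq_pmull.
  have low2 : #|L2| < threshold s0.
    apply: few_low E_gt0 blocks _ _ _ G01 (subsetDl _ _) _.
    by apply: leq_trans cR1; rewrite leq_pmull.
  have : #|fiber f s0| <= #|L1 :|: L2|.
    apply/subset_leq_card/subsetP => x xf; rewrite !inE.
    move: (xf); rewrite inE => -> /=; rewrite !ltnNge -negb_and.
    by apply/negP => H; apply: no; exists x.
  have := (leq_card_setU L1 L2).1; have := room _ s0w.
  by clear -low1 low2; lia.
pose B1 := nbrs h v0 R1; pose Bl := nbrs h v0 S0.
pose its := (s1, B1) :: rcons [seq (i, fiber f i :\: S0) | i <- mid] (sl, Bl).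
have fst_its : [seq q.1 | q <- its] = behead w.
  by rewrite /its /= map_rcons -map_comp /= map_id.
have sz : size its = (size w).-1 by rewrite -(size_map (fun q => q.1)) fst_its size_behead.
have fw (q : 'I_K * {set T}) : q \in its -> q.2 \subset fiber f q.1.
  rewrite inE mem_rcons inE => /or3P[/eqP->|/eqP->|/mapP[i _ ->]] /=.
  - exact: subset_trans (nbrs_sub _ _ _) (subsetDl _ _).
  - exact: subset_trans (nbrs_sub _ _ _) sS0.
  - exact: subsetDl.
have v0S0 : v0 \notin S0.
  apply/negP => /(subsetP sS0) v0l; move: Gsl0.
  by rewrite (fiber_disjoint v0l v0f) Gi.
have nv0 (Y : {set T}) : v0 \notin Y -> Y :\: [set v0] = Y.
  by move=> v0Y; apply/setDidPl; rewrite disjoint_sym disjoints1.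
have v0B1 : v0 \notin B1.
  apply/negP => /(subsetP (nbrs_sub _ _ _)); rewrite inE => /andP[_ v01].
  by move: G01; rewrite (fiber_disjoint v0f v01) Gi.
have v0Bl : v0 \notin Bl by apply: contra v0S0; apply: (subsetP (nbrs_sub _ _ _)).
have rm : roomy E f [set v0] its.
  apply: roomyP => -[|q1 w1] q w2 /= [].
    move=> <- _ /=; rewrite addn0 nv0 //.
    by clear -cR1 dR1; rewrite /B1; lia.
  move=> <- {q1}; case/lastP: w2 => [|w2 z]; last first.
    rewrite -rcons_cons -rcons_cat => /rcons_inj[eqm _].
    have /mapP[i im qE] : q \in [seq (i, fiber f i :\: S0) | i <- mid].
      by rewrite eqm mem_cat mem_head orbT.
    have iw : i \in w by rewrite !inE mem_rcons inE im !orbT.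
    have sub : count (fun q' : 'I_K * {set T} => ~~ [disjoint q'.2 & q.2]) ((s1, B1) :: w1) <=
        count_mem i w.
      apply: (@leq_trans (count_mem i [seq q'.1 | q' <- (s1, B1) :: w1])).
        rewrite count_map.
        set a := (a in count a _); rewrite (@eq_in_count _ a (fun q' => a q' && (q'.1 == i))).
          by apply: sub_count => q' /andP[].
        move=> q' q'w; have [aq|//] := boolP (a q').
        move: aq => /pred0Pn[x /andP[x1 x2]] /=.
        have q'i : q' \in its.
          move: q'w; rewrite !inE mem_rcons inE eqm mem_cat => /orP[->//|->].
          by rewrite !orbT.
        have xi : x \in fiber f i by move: x2; rewrite qE /= in_setD => /andP[].
        by rewrite (fiber_disjoint (subsetP (fw _ q'i) _ x1) xi) eqxx.
      have -> : count_mem i w = (s0 == i) + (count_mem i [seq q'.1 | q' <- its]).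
        by rewrite fst_its.
      rewrite /its eqm /= map_rcons map_cat -cats1 !count_cat /=.
      by clear; lia.
    have := room _ iw; rewrite qE /= in sub *.
    have c1 := subset_leq_card (subsetIr (fiber f i) S0); rewrite cS0 in c1.
    rewrite (cardsD _ [set v0]) (cardsD _ S0).
    have : #|(fiber f i :\: S0) :&: [set v0]| <= 1.
      by apply: leq_trans (subset_leq_card (subsetIr _ _)) _; rewrite cards1.
    have c2 : #|fiber f i :&: S0| <= 54 * threshold i.
      have [ii|ne] := eqVneq sl i; first by rewrite -ii in c1 *.
      rewrite (_ : _ :&: _ = set0) ?cards0 //.
      apply/setP => x; rewrite !inE; apply/negP => /andP[/eqP x1 /(subsetP sS0)].
      by rewrite inE x1 => /eqP si; rewrite si eqxx in ne.
    move: sub (th i) c2; rewrite /=; set a := (_ + count _ _); set b := count_mem _ _.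
    by clear; lia.
  rewrite cats1 => /rcons_inj[w1E qE]; rewrite -qE /= nv0 //.
  (* All earlier items avoid [S0], so none takes a vertex of [Bl]. *)
  have dis : all (fun q' : 'I_K * {set T} => [disjoint q'.2 & Bl]) ((s1, B1) :: w1).
    apply/allP => q' q'w; rewrite disjoint_sym; apply: (disjointWl (nbrs_sub _ _ _)).
    rewrite disjoint_sym; apply/pred0P => x /=; apply/negbTE/negP => /andP[xq xS].
    move: q'w xq; rewrite -w1E inE => /orP[/eqP->|/mapP[i _ ->]] /=.
      by move/(subsetP (nbrs_sub _ _ _)); rewrite in_setD xS.
    by rewrite in_setD xS.
  have /eqP -> : (~~ [disjoint B1 & Bl]) + count (fun q' : 'I_K * {set T} => ~~ [disjoint q'.2 & Bl]) w1 == 0.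
    rewrite -[_ + _]/(count (fun q' : 'I_K * {set T} => ~~ [disjoint q'.2 & Bl]) ((s1, B1) :: w1)).
    by rewrite -leqn0 leqNgt -has_count -all_predC; apply: sub_all dis => q' /= ->.
  by clear -cS0 dS0; rewrite /Bl; lia.
have nth_its j : j < size its -> (nth (s0, set0) its j).1 = nth s0 w j.+1.
  by move=> lj; rewrite -(nth_map _ s0 (fun q => q.1)) // fst_its nth_behead.
have wadj j : j.+1 < size w -> G (nth s0 w j) (nth s0 w j.+1).
  move: cw; rewrite -[cycle _ _]/(path G s0 (rcons (s1 :: rcons mid sl) s0)) rcons_path => /andP[pw _] lj.
  by move/(pathP s0): pw => /(_ j); apply.
have [||N2s|v [[sv uv vU] vB [v0' v1'] vh vd]] :=
    @embed _ h E D K f G E_gt0 blocks its [set v0] B1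
      ((nth (s0, set0) its 1).2 :\: [set v0]) x0 (s0, set0) rm _ fw.
- by move=> j lj; rewrite !nth_its //; [apply: wadj; move: lj; rewrite sz|apply: ltnW].
- by move=> _ /=; rewrite nv0 // subxx; split=> //; clear -cR1 dR1; rewrite /B1; lia.
- split=> //; have := rm; rewrite /its /= => -[_ rm2].
  have /card_gt0P[y yB1] : 0 < #|B1| by clear -cR1 dR1 th; have := th s1; rewrite /B1; lia.
  have := rm2 y yB1; move: N2s; rewrite /its /=.
  case: (rcons _ _) => //= q its' _ [le _].
  apply: (@leq_trans (18 * threshold q.1)); first by rewrite leq_mul2r orbT.
  by apply: leq_trans le _; apply/subset_leq_card/setDS; apply: subsetUr.
have szw : size w = (size its).+1 by rewrite sz.
exists (v0 :: v); split.
- by rewrite szw /= sv.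
- by rewrite /= uv andbT; apply/negP => /vU; rewrite inE eqxx.
- case=> [|j] lj /=.
    have : nth x0 v 0 \in B1 by apply: v0'; rewrite sz.
    by rewrite inE => /andP[].
  by apply: vh; move: lj; rewrite szw.
- have : nth x0 v (size its).-1 \in Bl.
    have -> : Bl = (nth (s0, set0) its (size its).-1).2.
      by rewrite nth_last /its /= last_rcons.
    by apply: vB.
  rewrite -sv nth_last inE => /andP[_]; rewrite hs /=.
  by case: (v) sv.
- case=> // j _ lj Gj /=; apply: vd; first by move: lj; rewrite szw.
  by rewrite !nth_its //; move: lj; rewrite szw; clear; lia.
Qed.
End EmbeddingCycle.

(** * Closed walks around triangles *)

Section Walks.
Variables (I : finType) (G : rel I).
Hypothesis Gs : symmetric G.
Implicit Types (w : seq I) (t : I * I * I) (ts : seq (I * I * I)) (m : I * I * I -> nat).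

(** Counts the short diagonals given up when [w] is embedded. *)
Fixpoint breaks w : nat :=
  if w is x :: w' then (if w' is _ :: z :: _ then nat_of_bool (~~ G x z) else 0) + breaks w' else 0.

Lemma breaks_cons x w : breaks (x :: w) <= (breaks w).+1.
Proof.
rewrite [breaks _]/= -[leqRHS]add1n leq_add2r.
by case: w => [|y [|z w]] //; case: (G x z).
Qed.

Lemma breaks_size w : breaks w <= size w.
Proof. by elim: w => // x w IH; apply: leq_trans (breaks_cons x w) _. Qed.

(** Only the two diagonals across the junction are new. *)
Lemma breaks_cat w1 w2 : breaks (w1 ++ w2) <= breaks w1 + 2 + breaks w2.
Proof.
elim: w1 => [|x w1 IH]; first by rewrite leq_addl.
case: w1 IH => [|y [|z w1]] IH.
- by apply: leq_trans (breaks_cons x w2) _; rewrite /=; clear; lia.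
- apply: leq_trans (breaks_cons x (y :: w2)) _; have := breaks_cons y w2.
  by rewrite [X in _ -> _ <= X + _ + _]/=; clear; lia.
- move: IH; set B := breaks _; set b := breaks _; set c := breaks w2 => IH.
  by change (~~ G x z + B <= ~~ G x z + b + 2 + c); clear -IH; lia.
Qed.

Lemma card_breaks w x0 n : size w = n ->
  #|[set j : 'I_n | (j.+2 < n) && ~~ G (nth x0 w j) (nth x0 w j.+2)]| <= breaks w.
Proof.
move=> <-; rewrite -sum1_card big_mkcond /=.
rewrite (eq_bigr (fun j : 'I_(size w) =>
   nat_of_bool ((j.+2 < size w) && ~~ G (nth x0 w j) (nth x0 w j.+2)))); last first.
  by move=> j _; rewrite inE; case: ifP.
elim: w => [|x w IH]; first by rewrite big_ord0.
rewrite big_ord_recl /=; apply: leq_add; last exact: IH.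
by case: w {IH} => [|y [|z w]].
Qed.

Definition repeat_triple t k := flatten (nseq k (corners t)).

Lemma size_repeat t k : size (repeat_triple t k) = 3 * k.
Proof. by elim: k => //= k IH; rewrite IH mulnS. Qed.

Lemma count_repeat t k i : count_mem i (repeat_triple t k) = k * count_mem i (corners t).
Proof. by elim: k => // k IH; rewrite mulSn /repeat_triple /= -IH /= !addnA addn0. Qed.

Lemma last_repeat t k : last t.2 (repeat_triple t k) = t.2.
Proof. by elim: k. Qed.

Lemma path_repeat t k : triangle G t -> path G t.2 (repeat_triple t k).
Proof.
case/and3P=> h1 h2 h3; elim: k => // k IH.
by rewrite /repeat_triple /= Gs h2 h1 h3.
Qed.

Lemma breaks_repeat t k : triangle G t -> breaks (repeat_triple t k) = 0.
Proof.
case/and3P=> h1 h2 h3; elim: k => // -[_|k IH]; first by rewrite /= h2.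
have h1' : G t.1.2 t.1.1 by rewrite Gs.
have h3' : G t.2 t.1.2 by rewrite Gs.
rewrite /repeat_triple /= in IH *; rewrite h2 in IH; rewrite h2 h1' h3'; exact: IH.
Qed.

Lemma short_path x y : connect G x y ->
  exists p, [/\ path G x p, last x p = y & size p <= #|I|].
Proof.
case/connectP=> p pp ->; case/shortenP: pp => p' pp' up' _; exists p'; split=> //.
by case/andP: up' => _ /card_uniqP <-; apply: max_card.
Qed.

(** The connecting paths are fixed before [m], so their total length [C] does not depend on [m] and
    the length of the walk can be tuned later. Each triangle has two junctions with at most two
    breaks each. *)
Lemma walk ts x : all (triangle G) ts -> (forall t, t \in ts -> connect G x t.2) ->
  exists C, C <= #|I| * size ts /\ forall m, exists w,
   [/\ path G x w, last x w = last x [seq t.2 | t <- ts],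
       size w = C + \sum_(t <- ts) 3 * m t,
       breaks w <= C + 4 * size ts &
       forall i, count_mem i w <= C + \sum_(t <- ts) m t * count_mem i (corners t)].
Proof.
elim: ts x => [|t ts IH] x /=.
  by exists 0; split=> // m; exists [::]; rewrite /= big_nil; split=> // i; rewrite big_nil.
case/andP=> tt tts conn.
have [p [pp lp sp]] := short_path (conn t (mem_head _ _)).
have [|C [leC HC]] := IH t.2 tts.
  move=> t' t'ts; apply: (connect_trans _ (conn t' _)); last by rewrite inE t'ts orbT.
  by rewrite sym_connect_sym //; apply: conn; rewrite mem_head.
exists (size p + C); split; first by rewrite mulnS leq_add.
move=> m; have [w [pw lw sw bw cw]] := HC m.
exists (p ++ repeat_triple t (m t) ++ w); split.
- by rewrite !cat_path pp lp path_repeat //= last_repeat.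
- by rewrite !last_cat lp last_repeat.
- by rewrite !size_cat size_repeat sw big_cons; clear; lia.
- have := breaks_cat p (repeat_triple t (m t) ++ w).
  have := breaks_cat (repeat_triple t (m t)) w; rewrite breaks_repeat //.
  by have := breaks_size p; move: bw; clear; lia.
- move=> i; rewrite !count_cat count_repeat big_cons.
  by rewrite addnACA addnA leq_add // leq_add2r count_size.
Qed.

(** The walk is led back to its start; [2 * k] extra steps between two corners of [t0] adjust its
    length modulo 3. *)
Lemma closed_walk ts t0 : t0 \in ts -> all (triangle G) ts ->
    {in ts &, forall t t', connect G t.2 t'.2} ->
  exists C, C <= #|I| * (size ts).+1 /\ forall m k, k <= 2 -> exists w,
   [/\ cycle G w, size w = C + 2 * k + \sum_(t <- ts) 3 * m t,
       breaks w <= C + 4 * size ts + 8 &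
       forall i, count_mem i w <= C + 4 + \sum_(t <- ts) m t * count_mem i (corners t)].
Proof.
move=> t0ts tts conn.
have [C [leC HC]] := walk tts (conn t0 ^~ t0ts).
set z := last t0.2 [seq t.2 | t <- ts] in HC.
have [t' t't zE] : exists2 t', t' \in ts & z = t'.2.
  have : z \in t0.2 :: [seq t.2 | t <- ts] by apply: mem_last.
  by rewrite inE => /orP[/eqP->|/mapP[t' ? ->]]; [exists t0|exists t'].
have [p [pp lp sp]] := short_path (conn _ _ t't t0ts).
exists (C + size p); split; first by rewrite mulnS addnC leq_add.
move=> m k k2; have [w [pw lw sw bw cw]] := HC m.
pose pad := flatten (nseq k [:: t0.1.1; t0.2]).
have [G1 G2 G3] : [/\ G t0.1.1 t0.1.2, G t0.1.1 t0.2 & G t0.1.2 t0.2].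
  by have /and3P := allP tts _ t0ts.
have spad : size pad = 2 * k by rewrite /pad; elim: (k) => //= k' ->; rewrite mulnS.
have ppad : path G t0.2 pad by rewrite /pad; elim: (k) => //= k' ->; rewrite Gs G2.
have lpad : last t0.2 pad = t0.2 by rewrite /pad; elim: (k).
exists (pad ++ w ++ p); split.
- have pall : path G t0.2 (pad ++ w ++ p) by rewrite !cat_path ppad lpad pw lw zE.
  rewrite (cycle_path t0.2); suff -> : last t0.2 (pad ++ w ++ p) = t0.2 by [].
  by rewrite !last_cat lpad lw zE.
- by rewrite !size_cat spad sw; clear; lia.
- have := breaks_cat pad (w ++ p); have := breaks_cat w p.
  have := breaks_size p; have := breaks_size pad; rewrite spad.
  by move: bw k2; clear; lia.
- move=> i; rewrite !count_cat.
  have cpad : count_mem i pad <= 4.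
    by apply: leq_trans (count_size _ _) _; rewrite spad; move: k2; clear; lia.
  apply: leq_trans (leq_add cpad (leq_add (cw i) (count_size _ p))) _.
  by set S := (\sum_(_ <- _) _)%N; clear; lia.
Qed.
End Walks.

(** * Assembling the cycle *)

Lemma exists_exact_sum (A : eqType) (ts : seq A) (m : A -> nat) s :
  uniq ts -> s <= \sum_(t <- ts) m t ->
  exists2 m' : A -> nat, forall t, m' t <= m t & \sum_(t <- ts) m' t = s.
Proof.
elim: ts s => [|t ts IH] s /=.
  by rewrite big_nil leqn0 => _ /eqP->; exists m => //; rewrite big_nil.
case/andP=> tts uts; rewrite big_cons => ls.
have [|m' le sm] := IH (s - m t) uts; first by rewrite leq_subLR.
exists (fun u => if u == t then minn s (m t) else m' u).
  by move=> u; case: eqP => [->|_]; rewrite ?geq_minr.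
rewrite big_cons eqxx (eq_big_seq m') ?sm; last first.
  by move=> u uts'; case: eqP => // ut; rewrite -ut uts' in tts.
by clear; lia.
Qed.

Lemma sum_count_undup (A : eqType) (L : seq A) (g : A -> nat) :
  \sum_(t <- undup L) count_mem t L * g t = \sum_(t <- L) g t.
Proof.
rewrite -[RHS]big_undup_iterop_count; apply: eq_bigr => t _.
by rewrite Monoid.iteropE iter_addn_0 mulnC.
Qed.

Lemma count_corners_of (A : finType) (L : seq (A * A * A)) i :
  count_mem i (corners_of L) = \sum_(t <- L) count_mem i (corners t).
Proof. by rewrite /corners_of count_flatten sumnE big_map big_map. Qed.

Section AlmostSquareCycle.
Variables (T : finType) (h : rel T) (E D K : nat) (f : T -> 'I_K) (G : rel 'I_K).
Hypothesis hs : symmetric h.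
Variables (F Q n n' : nat) (L : seq ('I_K * 'I_K * 'I_K)).
Hypothesis F_gt0 : 0 < F.
Hypothesis D_gt0 : 0 < D.
Hypothesis EF : 218 * F <= E.
Hypothesis blocks : dense_blocks h E D f G.
Hypothesis triangles : block_triangles f G n' L.
Hypothesis KQ : K <= Q.

Let R := Q * (Q * Q * Q).+1.

Hypothesis T_large : 2 * F * (R + 113) * D <= #|T|.
Hypothesis n_large : R + 7 <= n.
Hypothesis n_small : F * n + 3 * F * (Q * Q * Q) <= 3 * n' * (F - 1).

Let ts := undup L.
Let Gs : symmetric G. Proof. by case: blocks. Qed.

Let size_ts : size ts <= Q * Q * Q.
Proof.
have /card_uniqP <- := undup_uniq L; apply: leq_trans (max_card _) _.
by rewrite !card_prod card_ord !leq_mul.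
Qed.

(** Scaling multiplicities by [(F - 1) / F] leaves a part [1 / F] of every cluster free for
    connecting paths and for the greedy choices. *)
Let keep t := (count_mem t L * (F - 1)) %/ F.

(** Rounding loses at most one per distinct triangle, which [n_small] allows for. *)
Let sum_keep : n <= 3 * \sum_(t <- ts) keep t.
Proof.
have [_ sL _ _] := triangles.
have sum1 : n' * (F - 1) = \sum_(t <- ts) count_mem t L * (F - 1).
  by rewrite sum_count_undup big_const_seq count_predT sL iter_addn_0 mulnC.
have : n' * (F - 1) <= F * \sum_(t <- ts) keep t + F * size ts.
  rewrite sum1 -sum1_size big_distrr /= [F * \sum_(_ <- _) 1]big_distrr /=.
  rewrite -big_split /=; apply: leq_sum => t _; rewrite /keep muln1.
  by rewrite {1}(divn_eq (count_mem t L * (F - 1)) F) mulnC leq_add2l ltnW // ltn_mod.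
move=> le; have sz := size_ts; rewrite -(leq_pmul2l F_gt0).
have : F * size ts <= F * (Q * Q * Q) by rewrite leq_mul2l sz orbT.
by clear -le n_small; lia.
Qed.

Let count_keep m i : (forall t, m t <= keep t) ->
  F * (\sum_(t <- ts) m t * count_mem i (corners t)) <= (F - 1) * #|fiber f i|.
Proof.
have [_ _ cL _] := triangles => mk.
apply: (@leq_trans ((F - 1) * count_mem i (corners_of L))); last by rewrite leq_mul2l cL orbT.
rewrite count_corners_of -[X in _ <= _ * X]sum_count_undup !big_distrr /=; apply: leq_sum => t _.
rewrite !mulnA leq_mul2r; apply/orP; right; rewrite [(F - 1) * _]mulnC.
apply: leq_trans (_ : F * keep t <= _); first by rewrite leq_mul2l mk orbT.
by rewrite /keep mulnC leq_trunc_div.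
Qed.

Lemma almost_square_cycle : exists v (x0 : T), [/\ size v = n, uniq v,
    forall j, j.+1 < n -> h (nth x0 v j) (nth x0 v j.+1),
    h (nth x0 v n.-1) (nth x0 v 0) &
    #|[set j : 'I_n | [&& 0 < j, j.+2 < n & ~~ h (nth x0 v j) (nth x0 v j.+2)]]|
      <= R + 4 * (Q * Q * Q) + 8].
Proof.
have [tL sL _ connL] := triangles.
have inL t : t \in ts -> t \in L by rewrite mem_undup.
have tts : all (triangle G) ts by apply/allP => t /inL; apply: (allP tL).
have cornerL t : t \in ts -> t.2 \in corners_of L.
  by move=> /inL tL'; apply/flatten_mapP; exists t; rewrite // !inE eqxx !orbT.
have [t0 t0ts] : exists t0, t0 \in ts.
  case Ets: ts => [|t ts']; last by exists t; rewrite mem_head.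
  by have := sum_keep; move: n_large; rewrite Ets big_nil; clear; lia.
have [|C [leC HC]] := closed_walk Gs t0ts tts.
  by move=> t t' /cornerL tt /cornerL tt'; apply: connL.
have CR : C <= R.
  apply: leq_trans leC _; rewrite card_ord leq_mul //.
(* Modulo 3, [k] is twice [n - C], so [2 * k] is four times, that is once, [n - C]. *)
have [k k2 kn] : exists2 k, k <= 2 & 3 %| n - C - 2 * k.
  have : 7 <= n - C by move: n_large CR; clear; lia.
  move: (n - C) => a a7; exists ((2 * a) %% 3); first by rewrite -ltnS ltn_mod.
  by clear -a7; lia.
pose s := (n - C - 2 * k) %/ 3.
have s3 : 3 * s = n - C - 2 * k by rewrite mulnC divnK.
have [|m mk sm] := @exists_exact_sum _ ts keep s (undup_uniq L).
  by have := sum_keep; clear -s3; lia.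
have [w [cw sw bw countw]] := HC m k k2.
have szw : size w = n.
  by rewrite sw -big_distrr /= sm s3; clear -n_large CR k2; lia.
(* Half of the free part [1 / F] covers [109 * (#|fiber f i| %/ E)] since [218 * F <= E]; the other
   half covers [R + 113], where [113 = 4 + 109]. *)
have room i : i \in w -> count_mem i w + 109 * threshold E f i <= #|fiber f i|.
  move=> iw; have [_ _ /(_ _ _ (next_cycle cw iw))/andP[_ big]] := blocks.
  have c1 := countw i; have c2 := count_keep i mk.
  have big' : 2 * F * (R + 113) <= #|fiber f i|.
    rewrite -(leq_pmul2l D_gt0); apply: leq_trans big.
    by rewrite mulnC.
  have th : 218 * F * (threshold E f i).-1 <= #|fiber f i|.
    by apply: leq_trans (leq_trunc_div #|fiber f i| E); rewrite mulnC leq_mul2l EF orbT.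
  rewrite -(leq_pmul2l F_gt0); move: c1 c2 th; rewrite /threshold succnK.
  move: (\sum_(_ <- _) _) (count_mem i w) (_ %/ _) => a b d c1 c2 th.
  have FA : F * #|fiber f i| = (F - 1) * #|fiber f i| + #|fiber f i|.
    by rewrite -mulSnr -subSn // subn1.
  have c3 : F * b <= F * (C + 4) + F * a by rewrite -mulnDr leq_mul2l c1 orbT.
  have c4 : F * (C + 4) <= F * (R + 4) by rewrite leq_mul2l leq_add2r CR orbT.
  move: c2 c3 c4 th big' FA; clear; move: #|fiber f i| R (F - 1) => A r F'.
  rewrite [109 * d.+1]mulnS !mulnDr -!mulnA; move: (F * (109 * d)) (mulnCA F 109 d).
  by move: (F * d) (F * r) (F * C) (F * b) (F * a) => ? ? ? ? ?; lia.
case: w cw sw bw countw szw room => [|s0 [|s1 w]] cw sw bw countw szw room.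
- by exfalso; move: n_large; rewrite -szw /=; move: R => r; clear; lia.
- by exfalso; move: n_large; rewrite -szw /=; move: R => r; clear; lia.
case/lastP: w cw sw bw countw szw room => [|mid sl] cw sw bw countw szw room.
  by exfalso; move: n_large; rewrite -szw /=; move: R => r; clear; lia.
have [x0 _] : exists x0 : T, true.
  have : 0 < #|fiber f s0| by apply: leq_trans (room s0 (mem_head _ _)); rewrite addn_gt0 orbT.
  by case/card_gt0P => x; exists x.
have E_gt0 : 0 < E by apply: leq_trans EF; rewrite muln_gt0.
have [v [sv uv hv lv dv]] := embed_cycle hs E_gt0 blocks x0 cw room.
exists v, x0; rewrite -szw sv in hv *; split=> //.
  by move: lv; rewrite -nth_last sv.
apply: (@leq_trans (C + 4 * size ts + 8)); last first.
  by rewrite leq_add2r leq_add // leq_mul2l size_ts orbT.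
apply: leq_trans bw; apply: leq_trans (card_breaks G s0 (erefl _)).
apply/subset_leq_card/subsetP => j; rewrite !inE => /and3P[j0 j2].
by rewrite j2 /=; apply: contra; apply: dv.
Qed.
End AlmostSquareCycle.

(** * From the vertex sequence to the Ramsey number *)

Lemma cycle_distP n (i j : 'I_n) d : cycle_dist i j = d ->
  (i + n = j + d \/ i = j + d :> nat) \/ (j + n = i + d \/ j = i + d :> nat).
Proof.
have arc (k l : 'I_n) : (k + n - l) %% n = d -> k + n = l + d \/ k = l + d :> nat.
  have lk := ltn_ord k; have ll := ltn_ord l.
  have [kl|kl] := leqP l k.
    rewrite (_ : k + n - l = k - l + n); last by clear -kl; lia.
    rewrite modnDr modn_small; last by clear -lk kl; lia.
    by clear -kl; lia.
  by rewrite modn_small; clear -kl lk ll; lia.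
rewrite /cycle_dist; case: leqP => _ /arc; by [left|right].
Qed.

(** A diagonal is encoded by the index it starts from. The three extra ones start at [0], [n - 2]
    and [n - 1]; the last two pass the end of the sequence. *)
Lemma cycle_of_seq N n (col : {set 'I_N} -> bool) c b (v : seq 'I_N) x0
    (h := fun x y => col [set x; y] == c) :
    3 <= n -> size v = n -> uniq v ->
    (forall j, j.+1 < n -> h (nth x0 v j) (nth x0 v j.+1)) ->
    h (nth x0 v n.-1) (nth x0 v 0) ->
    #|[set j : 'I_n | [&& 0 < j, j.+2 < n & ~~ h (nth x0 v j) (nth x0 v j.+2)]]| <= b ->
  contains_almost_square_cycle n (b + 3) (color_class col c).
Proof.
move=> n3 sv uv hv hl hb; split=> //.
pose g (i : 'I_n) := nth x0 v i.
have gi : injective g.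
  by move=> i j /eqP; rewrite nth_uniq ?sv // => /eqP/val_inj.
have pairE (i j : 'I_n) : i != j -> (g @: [set i; j] \in color_class col c) = h (g i) (g j).
  by move=> ij; rewrite imsetU1 imset_set1 inE cards2 (inj_eq gi) ij.
have hC x y : h x y = h y x by rewrite /h setUC.
exists g; split=> //.
  move=> _ /imsetP[[i j] + ->]; rewrite inE /= => /eqP dij.
  have li := ltn_ord i; have lj := ltn_ord j.
  wlog arc : i j li lj {dij} / i + n = j + 1 \/ i = j + 1 :> nat.
    by move=> W; have [arc|arc] := cycle_distP dij; [|rewrite setUC]; apply: W.
  rewrite pairE; last by apply/eqP => ij; rewrite ij in arc; clear -arc n3; lia.
  rewrite hC /g; case: arc => [arc|arc]; last by rewrite arc addn1; apply: hv; rewrite -[j.+1]addn1 -arc.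
  have [-> ->] : (i = 0 :> nat) /\ (j = n.-1 :> nat) by clear -arc li lj; lia.
  exact: hl.
pose next2 (j : 'I_n) : 'I_n := Ordinal (ltn_pmod (j + 2) (leq_ltn_trans (leq0n j) (ltn_ord j))).
pose A := [set j : 'I_n | [&& 0 < j, j.+2 < n & ~~ h (nth x0 v j) (nth x0 v j.+2)]].
pose B := [set j : 'I_n | (j == 0 :> nat) || (n <= j.+2)].
have cB : #|B| <= 3.
  rewrite cardE -(size_map val) -[3]/(size [:: 0; n.-2; n.-1]).
  apply: uniq_leq_size; first by rewrite map_inj_uniq ?enum_uniq //; apply: val_inj.
  move=> _ /mapP[j + ->]; rewrite mem_enum !inE => H; have lj := ltn_ord j.
  by move: H lj; rewrite /=; move: (nat_of_ord j) => z; clear -n3; lia.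
apply: leq_trans (_ : #|[set [set j; next2 j] | j in A :|: B]| <= _); last first.
  apply: leq_trans (leq_imset_card _ _) _; apply: leq_trans (leq_card_setU _ _) _.
  exact: leq_add.
apply/subset_leq_card/subsetP => _ /setIdP[/imsetP[[i j] + ->]]; rewrite inE /= => /eqP dij.
have li := ltn_ord i; have lj := ltn_ord j.
wlog arc : i j li lj {dij} / i + n = j + 2 \/ i = j + 2 :> nat.
  by move=> W; have [arc|arc] := cycle_distP dij; [|rewrite setUC]; apply: W.
have iE : i = next2 j.
  apply: val_inj => /=; case: arc => [<-|<-]; first by rewrite modnDr modn_small.
  by rewrite modn_small.
move=> nE; apply/imsetP; exists j; last by rewrite setUC -iE.
rewrite !inE; have [->//|j0] := eqVneq (nat_of_ord j) 0.
have [jn|jn] := ltnP j.+2 n; last by rewrite /= ?orbT.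
rewrite lt0n j0 /= orbF.
have ij : i = j.+2 :> nat by clear -arc jn; lia.
move: nE; rewrite pairE; last by apply/eqP => e; rewrite e in ij; clear -ij; lia.
by rewrite hC /g ij.
Qed.

Lemma least_ramsey n c N : 0 < N -> ramsey_property n c N ->
  exists2 M, is_ramsey_number n c M & M <= N.
Proof.
move=> N0 rN; pose P M := `[< 0 < M /\ ramsey_property n c M >].
have exP : exists M, P M by exists N; apply/asboolP.
case: (ex_minnP exP) => M /asboolP[M0 rM] minM; exists M; last by apply/minM/asboolP.
by split=> // M' M'0 rM'; apply/minM/asboolP.
Qed.

Lemma almost_square_cycleW N n c c' (E : {set {set 'I_N}}) : c <= c' ->
  contains_almost_square_cycle n c E -> contains_almost_square_cycle n c' E.
Proof. by move=> cc' [n3 [g [gi ge gd]]]; split=> //; exists g; split=> //; apply: leq_trans cc'. Qed.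

(** Up to rounding, [3 * n'] is at least [(1 + 1 / k) * (1 - 122 / F) * n]. With [F = 300 * k] the
    product [(1 + 1 / k) * (1 - 122 / F) * (1 - 1 / F)] exceeds 1, and the surplus absorbs rounding
    and [q]. *)
Lemma packing_size_bound (k F n N n' q : nat) : 0 < k -> F = 300 * k ->
    7 * k.+1 * n <= 3 * k * N + 3 * k -> (F - 122) * N <= 7 * F * n' + 7 * F ->
    F * q.+1 <= n ->
  F * n + 3 * F * q <= 3 * n' * (F - 1).
Proof.
case: k => // k _ ->.
rewrite (_ : 300 * k.+1 - 122 = 300 * k + 178); last by lia.
rewrite (_ : 300 * k.+1 - 1 = 300 * k + 299); last by lia.
set F' := 300 * k.+1 => h1 h2 h3.
(* With these multiples of the hypotheses the goal is linear in the monomials, whose signs are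
   supplied below. *)
have g1 := leq_mul (leqnn (3 * (300 * k + 299) * k.+1)) h2.
have g2 := leq_mul (leqnn ((300 * k + 299) * (300 * k + 178))) h1.
have g3 := leq_mul (leqnn (F' * k.+1)) h3.
rewrite -(leq_pmul2l (_ : 0 < 7 * F' * k.+1)); last by rewrite !muln_gt0.
rewrite /F' in g1 g2 g3 *; clear -g1 g2 g3.
have p1 := leq0n (n * k); have p2 := leq0n (n * k * k); have p3 := leq0n (n * k * k * k).
have p4 := leq0n (k * k); have p5 := leq0n (k * k * k); have p6 := leq0n (k * k * k * k).
have p7 := leq0n (q * k); have p8 := leq0n (q * k * k).
have p9 := leq0n (q * k * k * k); have p10 := leq0n (q * k * k * k * k).
lia.
Qed.

Lemma ramsey_upper k : 0 < k -> exists c, forall n, c <= n ->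
  0 < n /\ ramsey_property n c ((7 * k.+1 * n) %/ (3 * k)).
Proof.
move=> k_gt0; pose F := 300 * k.
have F_gt0 : 0 < F by rewrite muln_gt0.
have F300 : 300 <= F by rewrite leq_pmulr.
have E_gt0 : 0 < F * F by rewrite muln_gt0 F_gt0.
have EF : 218 * F <= F * F by rewrite leq_mul2r (leq_trans _ F300) ?orbT.
have E6 : 6 <= F * F by apply: leq_trans EF; clear -F_gt0; lia.
have [Q reg] := regularity E_gt0.
pose q := Q * Q * Q; pose R := Q * q.+1.
pose c1 := 2 * F * (R + 113) * (Q * F).
(* The sum of all lower bounds required of [n] and of the number of lost diagonals, so that one
   constant serves both. *)
exists (F + F * q.+1 + c1 + (R + 7) + (R + 4 * q + 8 + 3)) => n cn.
have [nF nq nc1 nR nc] : [/\ F <= n, F * q.+1 <= n, c1 <= n, R + 7 <= n &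
    R + 4 * q + 8 + 3 <= F + F * q.+1 + c1 + (R + 7) + (R + 4 * q + 8 + 3)].
  by clearbody c1 R; move: (F * q.+1) cn => a; clear; split; lia.
set c := (F + _ + _ + _ + _) in cn nc *.
have n_gt0 : 0 < n by apply: leq_trans nF.
split=> // col; set N := _ %/ _ in col *.
have k3 : 0 < 3 * k by rewrite muln_gt0.
have N7 : 7 * k.+1 * n <= 3 * k * N + 3 * k.
  by rewrite -mulnSr; apply/ltnW; rewrite [ltnRHS]mulnC ltn_ceil.
have nN : n <= N.
  by rewrite /N leq_divRL // mulnC leq_mul2r; apply/orP; right; clear; lia.
(* The largest number of triangles that [reduced_triangles] provides. *)
pose n' := ((F - 122) * N) %/ (7 * F).
have F7 : 0 < 7 * F by rewrite muln_gt0.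
have n'lo : (F - 122) * N <= 7 * F * n' + 7 * F.
  by rewrite -mulnSr; apply/ltnW; rewrite [ltnRHS]mulnC ltn_ceil.
have n'hi : 7 * n' * F + 122 * N <= F * N.
  have := leq_trunc_div ((F - 122) * N) (7 * F); rewrite -/n' mulnBl.
  have : 122 * N <= F * N by rewrite leq_mul2r (leq_trans _ F300) ?orbT.
  by rewrite mulnA [n' * 7]mulnC; clear; lia.
pose e (x y : 'I_N) := col [set x; y].
have es : symmetric e by move=> x y; rewrite /e setUC.
have [K [f [KQ small irr]]] := reg _ e.
have FN : F <= #|'I_N| by rewrite card_ord (leq_trans nF).
have n'hi' : 7 * n' * F + 122 * #|'I_N| <= F * #|'I_N| by rewrite card_ord.
have [b [L [blocks triangles]]] :=
  reduced_triangles es F_gt0 E6 (leqnn _) small irr FN n'hi'.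
have hs : symmetric (fun x y => e x y == b) by move=> x y; rewrite es.
have K_gt0 : 0 < K.
  have N_gt0 : 0 < N by apply: leq_trans nN.
  by apply: leq_ltn_trans (ltn_ord (f (Ordinal N_gt0))).
have D_gt0 : 0 < K * F by rewrite muln_gt0 K_gt0.
have large : 2 * F * (R + 113) * (K * F) <= #|'I_N|.
  rewrite card_ord (leq_trans _ nN) // (leq_trans _ nc1) // leq_mul2l.
  by rewrite leq_mul2r KQ !orbT.
have [v [x0 [sv uv hv hl hb]]] :=
  almost_square_cycle hs F_gt0 D_gt0 EF blocks triangles KQ large nR
    (packing_size_bound k_gt0 (erefl F) N7 n'lo nq).
exists b; apply: almost_square_cycleW nc _.
apply: cycle_of_seq sv uv hv hl hb.
by apply: leq_trans nR; rewrite -[3]add0n leq_add.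
Qed.

Local Open Scope ring_scope.

Theorem theorem3 (R : realType) (eta : R) (heta : 0 < eta) :
  exists c : nat, forall n : nat, (c <= n)%N ->
    exists N : nat,
      is_ramsey_number n c N /\ N%:R <= (1 + eta) * (7 * n%:R / 3).
Proof.
have [k k_gt0 keta] : exists2 k : nat, (0 < k)%N & k%:R^-1 <= eta.
  exists (Num.trunc eta^-1).+1 => //.
  rewrite invf_ple ?posrE ?ltr0n //; apply/ltW/truncnS_gt.
have [c Hc] := ramsey_upper k_gt0.
exists c => n cn; have [n_gt0 ramN] := Hc n cn.
have k3 : (0 < 3 * k)%N by rewrite muln_gt0.
have N_gt0 : (0 < (7 * k.+1 * n) %/ (3 * k))%N.
  rewrite divn_gt0 //; apply: (@leq_trans (7 * k.+1)); last by rewrite leq_pmulr.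
  by clear; lia.
have [M ramM MN] := least_ramsey N_gt0 ramN; exists M; split=> //.
apply: (@le_trans _ _ ((7 * k.+1 * n)%:R / (3 * k)%:R)).
  rewrite ler_pdivlMr ?ltr0n // -natrM ler_nat.
  by apply: leq_trans (leq_trunc_div _ (3 * k)); rewrite leq_mul2r MN orbT.
have -> : (7 * k.+1 * n)%:R / (3 * k)%:R = (1 + k%:R^-1) * (7 * n%:R / 3) :> R.
  rewrite !natrM -natr1; field.
  by rewrite pnatr_eq0 -lt0n.
by rewrite ler_wpM2r ?lerD2l // divr_ge0 // mulr_ge0.
Qed.
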